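(* Let $(X,C)$ be a strongly ordered separable Banach space. Let $F_0:X\to X$ be a compact $C^1$-map such that for every $x\in X$ the Fréchet derivative $DF_0(x)$ is strongly positive, i.e. $DF_0(x)v\gg 0$ whenever $v>0$. Assume that $F_0$ is pointwise dissipative, with an attractor $A$. Let $B_1\supset A$ be an open ball, let $\epsilon_0>0$ and $J=[-\epsilon_0,\epsilon_0]\subset\mathbb{R}$. Then there exists $\eta>0$ such that the following holds for every compact $C^1$-map $F:J\times X\to X$, $(\epsilon,x)\mapsto F_\epsilon(x)$ (so $DF(\epsilon,x)$ depends continuously on $(\epsilon,x)\in J\times X$), whose member at $\epsilon=0$ is the given map $F_0$ and which satisfies $$\sup\{\|F_\epsilon x-F_0x\|+\|DF_\epsilon(x)-DF_0(x)\| :\ \epsilon\in J,\ x\in B_1\}<\eta .$$ There exist a closed bounded set $M\subset X$ whose interior contains $A$, an integer $q>0$ and an $\epsilon_1>0$ such that, for each $\epsilon\in(-\epsilon_1,\epsilon_1)$: (i) $F_\epsilon^q(M)\subset M$; and (ii) the set $$S_\epsilon:=\{x\in M:\ \lambda_{\max}(x,F_\epsilon)>0\}$$ is shy. In particular, if $X=\mathbb{R}^d$, then $S_\epsilon$ has Lebesgue measure zero.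
   Context: Order: A cone $C$ in a Banach space $(X,\|\cdot\|)$ is a closed convex subset with $\lambda C\subset C$ for all $\lambda>0$ and $C\cap(-C)=\{0\}$. $(X,C)$ is a strongly ordered Banach space if $C$ has nonempty interior $\mathrm{Int}\,C$. Write $x\le y$ if $y-x\in C$, $x<y$ if $y-x\in C\setminus\{0\}$, $x\ll y$ if $y-x\in \mathrm{Int}\,C$ (reversed signs in the usual way). Maps: A map is compact if it is continuous and sends bounded sets to relatively compact sets. $DF_\epsilon(x)$ denotes the Fréchet derivative of $F_\epsilon$ with respect to $x$. A set $B$ attracts a set $S$ under $h$ if $\sup_{x\in S}\mathrm{dist}(h^n x,B)\to 0$ as $n\to\infty$. A continuous map $h:X\to X$ is pointwise dissipative if there is a bounded set $B\subset X$ attracting each point of $X$. An attractor of $h$ is an invariant set $A$ ($h(A)=A$) that is the maximal compact invariant set and attracts each bounded subset of $X$. Largest Lyapunov exponent: for a $C^1$-map $h:X\to X$ and $x\in X$, $$\lambda_{\max}(x,h)=\liminf_{n\to+\infty}\frac{\log\|Dh^n(x)\|}{n},$$ with the convention $\log 0=-\infty$. Shyness: a Borel subset $W\subset X$ is shy if there is a nonzero finite compactly supported Borel measure $\mu$ on $X$ with $\mu(W+x)=0$ for every $x\in X$. *)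

(* Defs.v *)
From HB Require Import structures.
From mathcomp Require Import all_boot all_order all_algebra.
From mathcomp Require Import all_classical all_reals all_analysis.

Set Implicit Arguments.
Unset Strict Implicit.
Unset Printing Implicit Defensive.
Import Order.TTheory GRing.Theory Num.Theory.
Import numFieldNormedType.Exports.
Local Open Scope classical_set_scope.
Local Open Scope ring_scope.

Definition separable (T : topologicalType) : Prop :=
  exists2 D : set T, countable D & dense D.

Section Order.
Context {R : realType} {X : normedModType R}.

Definition cone (C : set X) : Prop :=
  [/\ closed C, convex_set C,
      (forall l : R, 0 < l -> [set l *: x | x in C] `<=` C)
    & C `&` [set - x | x in C] = [set 0]].

Definition strongly_ordered (C : set X) : Prop := cone C /\ C° !=set0.

Definition cone_lt (C : set X) (x y : X) : Prop := (C `\ 0) (y - x).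

Definition cone_ll (C : set X) (x y : X) : Prop := C° (y - x).

Definition strongly_positive (C : set X) (L : X -> X) : Prop :=
  forall v, cone_lt C 0 v -> cone_ll C 0 (L v).

End Order.

Section Calculus.
Context {R : realType}.

(* Extended-real valued, so that it is +oo when L is unbounded on the unit
   ball. *)
Definition opnorm {V W : normedModType R} (L : V -> W) : \bar R :=
  ereal_sup [set `|L v|%:E | v in [set v | `|v| <= 1]].

Definition compact_map_on {V W : normedModType R} (D : set V) (f : V -> W) :
    Prop :=
  {within D, continuous f} /\
  forall S : set V, S `<=` D -> bounded_set S -> precompact (f @` S).

Definition C1_map {V W : normedModType R} (f : V -> W) : Prop :=
  (forall x, differentiable f x) /\
  forall x, opnorm (fun v => 'd f y v - 'd f x v) @[y --> x] --> 0%E.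

(* Fréchet derivatives are taken relative to D; this is meant for sets D with
   dense interior, such as a closed interval times a normed space (the
   derivative is then one-sided in the interval variable at the endpoints). *)
Definition C1_map_on {V W : normedModType R} (D : set V) (f : V -> W) : Prop :=
  exists Df : V -> {linear V -> W},
    (forall x, D x -> continuous (Df x) /\
       (fun y => f y - f x - Df x (y - x)) =o_ (within D (nbhs x))
         (fun y => y - x)) /\
    (forall x, D x ->
       opnorm (fun v => Df y v - Df x v) @[y --> within D (nbhs x)] --> 0%E).

End Calculus.

Section Dynamics.
Context {R : realType} {X : normedModType R}.
Implicit Types (h : X -> X) (A B S : set X).

(* The distance to the empty set is +oo; the maximum with 0 makes the supremum
   over an empty S equal to 0, so that every set attracts the empty set. *)
Definition attracts h B S : Prop :=
  maxe 0%E (ereal_sup [set edist_inf B (iter n h x) | x in S])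
    @[n --> \oo] --> 0%E.

Definition pointwise_dissipative h : Prop :=
  exists2 B : set X, bounded_set B & forall x, attracts h B [set x].

Definition attractor h A : Prop :=
  [/\ compact A, h @` A = A,
      (forall K, compact K -> h @` K = K -> K `<=` A)
    & (forall S, bounded_set S -> attracts h A S)].

(* lne 0 = -oo; the meaningless term n = 0 does not affect the lower limit. *)
Definition lambda_max (x : X) h : \bar R :=
  limn_einf (fun n => lne (opnorm ('d (iter n h) x)) * (n%:R^-1)%:E)%E.

End Dynamics.

Notation borel_space X := (g_sigma_algebraType (@open X)).

Section Shy.
Context {R : realType} {X : normedModType R}.

Definition shy (W : set X) : Prop :=
  measurable (W : set (borel_space X)) /\
  exists mu : {finite_measure set (borel_space X) -> \bar R},
    [/\ mu setT != 0%E,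
        (exists2 K : set X, compact K & mu (~` K) = 0%E)
      & forall x : X, mu [set w + x | w in W] = 0%E].

End Shy.

Section Lebesgue.
Context {R : realType} {d : nat}.

Definition box (a b : 'rV[R]_d) : set 'rV[R]_d :=
  [set x | forall i, a 0 i <= x 0 i <= b 0 i].

Definition box_volume (a b : 'rV[R]_d) : R := \prod_(i < d) (b 0 i - a 0 i).

(* Covers are indexed by a set D of natural numbers so that the empty set has
   an empty cover, also when d = 0 (no box is empty then). *)
Definition lebesgue_outer_measure (S : set 'rV[R]_d) : \bar R :=
  ereal_inf [set s | exists (D : set nat) (a b : nat -> 'rV[R]_d),
    [/\ forall k i, a k 0 i <= b k 0 i,
        S `<=` \bigcup_(k in D) box (a k) (b k)
      & s = (\esum_(k in D) (box_volume (a k) (b k))%:E)%E]].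

Definition lebesgue_null (S : set 'rV[R]_d) : Prop :=
  lebesgue_outer_measure S = 0%E.

End Lebesgue.

(* Main.v *)
(** Fix e in the interior of C and a compact set K that contains the F_0-orbits
    of all points that the maps F_eps reach in one step from a ball around the
    attractor.  By strong positivity and compactness, for small rho the vectors v
    with DF_0(y) v >= rho |v| e for all y in K form a set that contains a
    neighbourhood of e and that every operator close to some DF_0(z), z in K,
    maps into itself.  For a small perturbation F, the derivatives along orbits
    near the attractor are such operators.  Therefore |DF^n(x)| is at most a
    constant times |DF^n(x) e|, and on a short segment x_0 + t e the vectors
    DF^n(x_0 + t e) e do not cancel: applying DF_0(y) and integrating gives
      rho (int_0^1 |DF^n(x_0 + t e) e| dt) e
        <= DF_0(y) (F^n(x_0 + e) - F^n(x_0)).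
    The right-hand side is bounded in n, so by Fatou's lemma |DF^n(x_0 + t e) e|
    tends to infinity for almost no t, whereas a positive exponent forces this
    growth.  Hence the length measure of the segment [0, e] witnesses shyness,
    and Fubini's theorem turns the null segments into a Lebesgue null set. *)

Require Import Defs.
From HB Require Import structures.
From mathcomp Require Import all_boot all_order all_algebra.
From mathcomp Require Import ring lra.
From mathcomp Require Import all_classical all_reals all_analysis measurable_realfun.

Set Implicit Arguments.
Unset Strict Implicit.
Unset Printing Implicit Defensive.
Import Order.TTheory GRing.Theory Num.Theory.
Import numFieldNormedType.Exports.
Local Open Scope classical_set_scope.
Local Open Scope ring_scope.

(** * Differential calculus *)

Section Compactness.
Context {R : realType}.

(** Half-radius balls suffice: a point within [rho x / 2] of [x] has its whole [d]-ball inside the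
    [rho x]-ball once [d < rho x / 2]. The clause [d < rho a] lets the same [d] bound a perturbation
    parameter as well as a distance. *)
Lemma lebesgue_number {V : normedModType R} (K : set V) (rho : V -> R) :
  compact K -> (forall x, K x -> 0 < rho x) ->
  exists2 d : R, 0 < d &
    forall x, K x -> exists a, [/\ K a, `|x - a| < rho a & d < rho a /\
      forall y, `|y - x| < d -> `|y - a| < rho a].
Proof.
move=> /compact_near_coveringP cK rho0.
pose P (d : R) x := exists a, [/\ K a, `|x - a| < rho a & d < rho a /\
      forall y, `|y - x| < d -> `|y - a| < rho a].
have cH : forall x, K x -> \forall x' \near x & d \near 0^'+, P d x'.
  move=> x Kx; have rx := rho0 _ Kx.
  have r2 : 0 < rho x / 2 by rewrite divr_gt0.
  exists (ball x (rho x / 2), [set d : R | d < rho x / 2]).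
    by split=> /=; [exact: nbhsx_ballx|exact: nbhs_right_lt].
  move=> [x' d] /= [+ dr]; rewrite -ball_normE /= distrC => xx'.
  exists x.
  split=> //; first by lra.
  split; first by lra.
  move=> y yx'; rewrite -(subrKA x') (le_lt_trans (ler_normD _ _))//; lra.
have [d [d0 KP]] : exists d : R, 0 < d /\ K `<=` P d.
  near (0 : R)^'+ => d; exists d; split=> //.
  by near: d; exact: cK cH.
by exists d => // x /KP.
Unshelve. all: by end_near. Qed.

End Compactness.

Section Opnorm.
Context {R : realType} {V W : normedModType R}.
Implicit Types L : V -> W.

Lemma opnorm_ub L v : `|v| <= 1 -> (`|L v|%:E <= opnorm L)%E.
Proof. by move=> v1; apply: ereal_sup_ubound; exists v. Qed.

(** Only homogeneity is asked of [L], so that a difference of two linear maps, written as a plain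
    function, qualifies. *)
Lemma le_opnorm_bound L (k : R) : (forall (a : R) v, L (a *: v) = a *: L v) ->
  (opnorm L <= k%:E)%E -> forall v, `|L v| <= k * `|v|.
Proof.
move=> LZ Lk v; have [->|v0] := eqVneq v 0.
  by rewrite -(scale0r 0) LZ !scale0r !normr0 mulr0.
have nv : 0 < `|v| by rewrite normr_gt0.
have nw : `| (`|v|^-1 *: v) | <= 1.
  by rewrite normrZ normfV normr_id mulVf// gt_eqF.
have := le_trans (opnorm_ub L nw) Lk.
by rewrite lee_fin LZ normrZ normfV normr_id mulrC ler_pdivrMr.
Qed.

Lemma opnorm_le L (k : R) : (forall v, `|v| <= 1 -> `|L v| <= k) ->
  (opnorm L <= k%:E)%E.
Proof. by move=> H; apply: ge_ereal_sup => _ [v v1 <-]; rewrite lee_fin H. Qed.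

End Opnorm.

Lemma nbhs0_lte {R : realType} (k : R) : 0 < k ->
  nbhs (0 : \bar R)%E [set z : \bar R | (z < k%:E)%E].
Proof.
by move=> k0; apply: open_nbhs_nbhs; split; [exact: open_ereal_lt_ereal|rewrite /= lte_fin].
Qed.

Section C1.
Context {R : realType} {X : normedModType R}.
Implicit Types h : X -> X.

Lemma C1_diff_near h x (eta : R) : C1_map h -> 0 < eta ->
  exists2 d : R, 0 < d & forall y, `|y - x| < d ->
    forall v, `|'d h y v - 'd h x v| <= eta * `|v|.
Proof.
move=> [_ /(_ x) hC] eta0.
have /hC := nbhs0_lte eta0.
move=> /= /nbhs_normP[d /= d0 dH]; exists d => // y yx.
apply: le_opnorm_bound.
  by move=> a v; rewrite !(linearZZ (diff _ _)) -scalerBr.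
by apply/ltW/dH; rewrite /= distrC.
Qed.

(** The difference of the values at (y, w) and (x, v) splits into ('d h y - 'd h x) w, small because
    w stays bounded by |v| + 1, and 'd h x (w - v), small because 'd h x is bounded. *)
Lemma diff_continuous2 h : C1_map h ->
  continuous (fun p : X * X => 'd h (p.1) (p.2)).
Proof.
move=> hC [x v]; apply/cvgrPdist_lt => /= eta eta0.
have [k k0 Lk] : exists2 k, 0 < k & forall u, `|'d h x u| <= k * `|u|.
  by apply: linear_lipschitz; apply: diff_continuous; exact: hC.1.
have e1 : 0 < eta / (2 * (`|v| + 1)).
  by rewrite divr_gt0// mulr_gt0// ltr_wpDl.
have [d d0 dH] := C1_diff_near x hC e1.
have e2 : 0 < eta / (2 * k) by rewrite divr_gt0// mulr_gt0.
pose m := Num.min d (Num.min 1 (eta / (2 * k))).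
have m0 : 0 < m by rewrite !lt_min d0 ltr01 e2.
exists (ball x m, ball v m); first by split; exact: nbhsx_ballx.
move=> p [+ +]; rewrite -!ball_normE/= /m !lt_min => /and3P[p1 _ _] /and3P[_ p21 p2k].
move: p1 p21 p2k; rewrite (distrC x) (distrC v) => p1 p21 p2k.
have np2 : `|p.2| < `|v| + 1.
  by rewrite -[p.2](subrK v) (le_lt_trans (ler_normD _ _))// addrC ltrD2l.
rewrite distrC -(subrKA ('d h x p.2)) (le_lt_trans (ler_normD _ _))//.
rewrite [ltRHS]splitr ler_ltD//.
  rewrite (le_trans (dH _ p1 _))//.
  rewrite invfM mulrA -[leRHS]mulr1 -[leLHS]mulrA ler_wpM2l//.
    by rewrite divr_ge0// ltW.
  by rewrite ler_pdivrMl ?mulr1 ?ltW// ltr_wpDl.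
rewrite -linearB (le_lt_trans (Lk _))// mulrC -ltr_pdivlMr//.
by rewrite -mulrA -invfM.
Qed.

Lemma diff_continuous_base h v : C1_map h -> continuous (fun x => 'd h x v).
Proof.
move=> hC x.
apply: (@continuous_comp _ _ _ (fun y => (y, v))
  (fun p : X * X => 'd h (p.1) (p.2))).
  by apply: cvg_pair => //; exact: cvg_cst.
exact: (diff_continuous2 hC).
Qed.

Lemma C1_iter_differentiable h n x : C1_map h -> differentiable (iter n h) x.
Proof.
move=> hC; elim: n => [|n IH]; first exact: ex_diff.
by rewrite (_ : iter n.+1 h = h \o iter n h)//; apply: differentiable_comp => //; exact: hC.1.
Qed.

Lemma diff_iterS h n x v : C1_map h ->
  'd (iter n.+1 h) x v = 'd h (iter n h x) ('d (iter n h) x v).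
Proof.
move=> hC; rewrite (_ : iter n.+1 h = h \o iter n h)// diff_comp//.
  exact: C1_iter_differentiable.
exact: hC.1.
Qed.

Lemma diff_iter0 h x v : 'd (iter 0 h) x v = v.
Proof. by rewrite (_ : iter 0 h = id)// diff_val. Qed.

Lemma C1_continuous h : C1_map h -> continuous h.
Proof. by move=> hC x; apply: differentiable_continuous; exact: hC.1. Qed.

Lemma C1_iter_continuous h n : C1_map h -> continuous (iter n h).
Proof.
move=> hC x; apply: differentiable_continuous; exact: C1_iter_differentiable.
Qed.

Lemma diff_iter_continuous h n v : C1_map h ->
  continuous (fun x => 'd (iter n h) x v).
Proof.
move=> hC; elim: n => [|n IH] x.
  under eq_fun do rewrite diff_iter0; exact: cvg_cst.
under eq_fun do rewrite diff_iterS//.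
apply: (@continuous_comp _ _ _ (fun y => (iter n h y, 'd (iter n h) y v))
  (fun p : X * X => 'd h (p.1) (p.2))).
  by apply: cvg_pair; [exact: C1_iter_continuous|exact: IH].
exact: (diff_continuous2 hC).
Qed.

End C1.

Section Slices.
Context {R : realType} {X : normedModType R}.
Variables (F : R * X -> X) (eps0 : R).
Hypothesis FC1 : C1_map_on (`[- eps0, eps0]%classic `*` setT) F.

Lemma C1_slices : exists T : R -> X -> X -> X,
  forall e x, - eps0 < e < eps0 ->
  [/\ differentiable (fun y => F (e, y)) x,
      'd (fun y => F (e, y)) x = T e x :> (X -> X)
    & forall eta, 0 < eta -> exists2 d : R, 0 < d &
      forall e' y, - eps0 < e' < eps0 -> `|e' - e| < d -> `|y - x| < d ->
      forall v, `|T e' y v - T e x v| <= eta * `|v|].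
Proof.
have [Df [DfF DfC]] := FC1.
exists (fun e x v => Df (e, x) (0, v)) => e x ee.
have Jx : (`[- eps0, eps0]%classic `*` [set: X]) (e, x).
  by split=> //=; rewrite in_itv/=; move/andP: ee => [/ltW-> /ltW->].
have [cDf oDf] := DfF _ Jx.
have lin : linear (fun v : X => Df (e, x) (0, v)).
  move=> a u v; rewrite -linearP; congr (Df _ _).
  by rewrite -[RHS]/(a *: (0 : R^o) + 0, a *: u + v) scaler0 addr0.
pose glM := GRing.isLinear.Build _ _ _ _ _ lin.
pose gL : {linear X -> X} := HB.pack (fun v : X => Df (e, x) (0, v)) glM.
have cg : continuous gL.
  move=> v; rewrite /gL/=.
  apply: (@continuous_comp _ _ _ (fun w : X => (0 : R, w)) (Df (e, x))).
    apply: (@cvg_pair _ _ _ _ (nbhs (0 : R)) (nbhs v)) => //; exact: cvg_cst.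
  exact: cDf.
(* The joint expansion is restricted to the line of points [(e, w + x)]. These stay in the domain,
   and the increment [(0, w)] has the norm of [w]. *)
have dg : (fun y => F (e, y)) \o shift x = cst (F (e, x)) + gL +o_ 0 id.
  apply/eqaddoP => /= k k0.
  move/eqoP : oDf => /(_ k k0); rewrite /= near_withinE => H.
  have : (fun w : X => (e, w + x)) @ 0 --> (e, x).
    apply: (@cvg_pair _ _ _ _ (nbhs e) (nbhs x)); first exact: cvg_cst.
    have : (fun w : X => w + x) @ (0 : X) --> 0 + x.
      by apply: cvgD => //; exact: cvg_cst.
    by rewrite add0r.
  move=> /(_ _ H) H2; apply: (filterS _ (H2 : nbhs (0 : X) _)) => w /= Hw.
  rewrite !fctE /shift /=.
  have {Hw} := Hw (conj Jx.1 I).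
  have -> : (e, w + x) - (e, x) = (0, w) :> R * X.
    by rewrite -[LHS]/(e - e, w + x - x) subrr addrK.
  have -> : `|(0 : R, w)| = `|w| by rewrite prod_normE/= normr0 max_r.
  by rewrite opprD addrA.
split.
- apply/diff_locallyP; rewrite (diff_unique cg dg); split=> //.
- exact: diff_unique cg dg.
move=> eta eta0.
have /(DfC _ Jx) := nbhs0_lte eta0.
rewrite /= nbhs_simpl/= -/(within _ _ _).
rewrite /within/= => /nbhs_normP[d /= d0 dH]; exists d => // e' y ee' e'e yx v.
have := @dH (e', y).
rewrite /= prod_normE/= gt_max distrC e'e distrC yx => /(_ isT).
have J' : (`[- eps0, eps0]%classic `*` [set: X]) (e', y).
  by split=> //=; rewrite in_itv/=; move/andP: ee' => [/ltW-> /ltW->].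
move=> /(_ J') /ltW /le_opnorm_bound H.
have -> : `|v| = `|(0 : R, v)| by rewrite prod_normE/= normr0 max_r.
apply: H => a u; by rewrite !(linearZZ (Df _)) -scalerBr.
Qed.

End Slices.

(** * Compact families of derivatives *)

Section CompactSets.

(** Compactness as an induction principle: a property of sets that holds locally and passes to
    subsets and finite unions holds for a compact set. *)
Lemma compact_ind (T : topologicalType) (K : set T) (Q : set T -> Prop) :
  compact K -> Q set0 ->
  (forall U V, Q U -> Q V -> Q (U `|` V)) ->
  (forall U V, U `<=` V -> Q V -> Q U) ->
  (forall x, K x -> exists2 U, nbhs x U & Q U) -> Q K.
Proof.
move=> /compact_near_coveringP cK Q0 QU Qs Ql.
(* Near [G] means: for every set with [Q] that contains a certain set with [Q]. Stability under
   unions makes this a filter. *)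
pose G : set_system (set T) :=
  [set S | exists2 U, Q U & forall V, Q V -> U `<=` V -> S V].
have FG : Filter G.
  constructor.
  - by exists set0.
  - move=> P P' [U QU' PU] [U' QU'' PU']; exists (U `|` U'); first exact: QU.
    move=> V QV sV; split; [apply: PU => //|apply: PU' => //].
      by apply: subset_trans sV; exact: subsetUl.
    by apply: subset_trans sV; exact: subsetUr.
  - by move=> P P' PP' [U QU' PU]; exists U => // V QV UV; apply/PP'/PU.
have : \forall U \near G, K `<=` (fun U x => U x) U.
  apply: cK => x Kx; have [U xU QU'] := Ql x Kx.
  exists (U, [set V | U `<=` V]) => /=.
    by split=> //; exists U.
  by move=> [y V] [/= Uy UV]; exact: UV.
by move=> [U QU' H]; apply: Qs (H U QU' _) QU'.
Qed.

End CompactSets.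

Section Precompact.
Context {R : realType}.

Lemma bounded_setP {V : normedModType R} (S : set V) :
  bounded_set S <-> exists M : R, forall x, S x -> `|x| <= M.
Proof.
split=> [/ex_strict_bound_gt0[M M0 SM]|[M SM]].
  by exists M => x Sx; apply/ltW; exact: SM.
exists M; split=> [|N MN x Sx]; first exact: num_real.
by rewrite /= (le_trans (SM _ Sx))// ltW.
Qed.

(** Total boundedness with compact nets in place of finite ones. An ultrafilter on the closure of
    [D] is Cauchy, hence converges by completeness. *)
Lemma precompact_nets {X : completeNormedModType R} (D : set X) :
  (forall eta : R, 0 < eta -> exists2 L, compact L &
     forall d, D d -> exists2 l, L l & `|d - l| < eta) ->
  precompact D.
Proof.
move=> nets; rewrite precompactE compact_ultra => G UG GD.
have cG : cauchy_ex G.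
  move=> e e0.
  (* If no ball of radius [e] belonged to [G], compactness of the net [L] would keep points near [G]
     at distance at least [e / 2] from all of [L]; but each point of the closure of [D] is within
     [e / 4 + e / 4] of [L]. *)
  have e4 : 0 < e / 4 by rewrite divr_gt0.
  have [L cL HL] := nets _ e4.
  apply: contrapT => /forallNP nG.
  have /compact_near_coveringP : compact L := cL.
  move=> /(_ _ G (fun i x => 2 * (e / 4) <= `|i - x|)) H.
  have [] : ~ G set0 by exact: filter_not_empty.
  have : \forall i \near G, L `<=` (fun x => 2 * (e / 4) <= `|i - x|).
    apply: H => x Lx.
    exists (ball x (e / 4), ~` ball x e) => /=.
      split; first exact: nbhsx_ballx.
      by have [/nG//|//] := in_ultra_setVsetC (ball x e) UG.
    move=> [y i] /= []; rewrite -!ball_normE/= => xy /negP; rewrite -leNgt => xi.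
    move: xi; rewrite distrC -(subrKA y) => xi.
    have := ler_normD (i - y) (y - x); rewrite (distrC y x); lra.
  move=> GL; apply: filterS (filterI GD GL) => i [cDi] Hi.
  have [d [Dd]] := cDi _ (nbhsx_ballx i _ e4); rewrite -ball_normE/= => id.
  have [l Ll dl] := HL _ Dd.
  have := Hi _ Ll; rewrite -(subrKA d); have := ler_normD (i - d) (d - l); lra.
have /cauchy_cvg : cauchy G by exact: cauchy_exP.
move=> Gl; exists (lim G); split=> //.
by apply: closed_closure => B /Gl GB; exact: filter_ex (filterI GD GB).
Qed.

(** The derivative of a compact map is compact: at a small fixed scale [s] the difference quotients
    approximate it uniformly on the unit ball, and they lie in an affine image of a compact set. *)
Lemma diff_precompact {X : completeNormedModType R} (h : X -> X) y :
  compact_map_on setT h -> C1_map h ->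
  precompact [set 'd h y v | v in [set v | `|v| <= 1]].
Proof.
move=> hc hC; apply: precompact_nets => eta eta0.
have /diff_locallyP[_ /eqaddoP] := hC.1 y.
have eta2 : 0 < eta / 2 by rewrite divr_gt0.
move=> /(_ _ eta2) /nbhs_normP[d /= d0 dH].
pose s := d / 2; have s0 : 0 < s by rewrite divr_gt0.
pose S := [set h (y + s *: v) | v in [set v : X | `|v| <= 1]].
exists ((fun x => s^-1 *: (x - h y)) @` closure S).
  apply: continuous_compact.
    apply: continuous_subspaceT => x; apply: cvgZ; first exact: cvg_cst.
    by apply: cvgB => //; exact: cvg_cst.
  rewrite -precompactE; have := hc.2 [set y + s *: v | v in [set v : X | `|v| <= 1]].
  rewrite image_comp; apply => //.
  apply/bounded_setP; exists (`|y| + s) => _ [v /= v1 <-].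
  rewrite (le_trans (ler_normD _ _))// lerD2l normrZ gtr0_norm//.
  by rewrite ler_piMr// ltW.
move=> _ [v /= v1 <-]; exists (s^-1 *: (h (y + s *: v) - h y)).
  by exists (h (y + s *: v)) => //; apply: subset_closure; exists v.
have : `|0 - s *: v| < d.
  rewrite sub0r normrN normrZ gtr0_norm// /s.
  have := normr_ge0 v; move: v1 d0; nra.
move=> /dH /=; rewrite !fctE/= => H.
have -> : 'd h y v - s^-1 *: (h (y + s *: v) - h y) =
    - (s^-1 *: (h (s *: v + y) - (h y + 'd h y (s *: v)))).
  rewrite (linearZZ (diff _ _)) opprD addrA [in RHS]scalerBr scalerA.
  by rewrite mulVf ?gt_eqF// scale1r opprB (addrC y).
rewrite normrN normrZ gtr0_norm ?invr_gt0// mulrC ltr_pdivrMr//.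
apply: (le_lt_trans H); rewrite normrZ gtr0_norm//.
have es := mulr_gt0 eta0 s0.
have : eta * s * `|v| <= eta * s by rewrite ler_piMr// ltW.
move: es; rewrite (_ : eta / 2 * (s * `|v|) = eta * s * `|v| / 2); last by ring.
set a := eta * s; lra.
Qed.

(** A net for the derivative at [x] serves, up to [eta / 2], for all nearby points, and finitely
    many such nets are united by [compact_ind]. *)
Lemma diff_family_precompact {X : completeNormedModType R} (h : X -> X) K :
  compact_map_on setT h -> C1_map h -> compact K ->
  precompact [set 'd h (p.1) (p.2) | p in [set p : X * X | K p.1 /\ `|p.2| <= 1]].
Proof.
move=> hc hC cK; apply: precompact_nets => eta eta0.
suff [L cL HL] : exists2 L, compact L & forall y v, K y -> `|v| <= 1 ->
    exists2 l, L l & `|'d h y v - l| < eta.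
  by exists L => // _ [[y v] /= [Ky v1] <-]; exact: HL.
have := @compact_ind _ K (fun U => exists2 L, compact L &
  forall y v, U y -> `|v| <= 1 -> exists2 l, L l & `|'d h y v - l| < eta) cK.
apply.
- by exists set0 => //; exact: compact0.
- move=> U V [L cL HL] [L' cL' HL']; exists (L `|` L'); first exact: compactU.
  move=> y v [/HL H|/HL' H] /H[l Ll]; exists l => //; by [left|right].
- by move=> U V UV [L cL HL]; exists L => // y v /UV; exact: HL.
move=> x Kx; have eta2 : 0 < eta / 2 by rewrite divr_gt0.
have [d d0 dH] := C1_diff_near x hC eta2.
exists (ball x d); first exact: nbhsx_ballx.
exists (closure [set 'd h x v | v in [set v | `|v| <= 1]]).
  by rewrite -precompactE; exact: diff_precompact.
move=> y v; rewrite -ball_normE/= distrC => /dH yd v1.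
exists ('d h x v); first by apply: subset_closure; exists v.
apply: (le_lt_trans (yd v)); move: (normr_ge0 v) v1 eta0; nra.
Qed.

End Precompact.

(** * Cones *)

Section RealInduction.
Context {R : realType}.

(** Cousin's lemma by a supremum argument: the supremum of the [s] with [P 0 s] could be passed by
    [d / 3] unless the end 1 is already within reach. Local validity is asked only of intervals that
    contain [t]. *)
Lemma interval_additive (P : R -> R -> Prop) :
  (forall a b c, a <= b -> b <= c -> P a b -> P b c -> P a c) ->
  (forall t, 0 <= t <= 1 -> exists2 d, 0 < d & forall a b,
     0 <= a -> a <= t -> t <= b -> b <= 1 -> b - a < d -> P a b) ->
  P 0 1.
Proof.
move=> Padd Ploc.
pose E := [set s | 0 <= s <= 1 /\ P 0 s].
have E0 : E 0.
  split; first by rewrite lexx ler01.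
  have [|d d0 H] := Ploc 0; first by rewrite lexx ler01.
  by apply: H; rewrite ?subrr.
have supE : has_sup E by split; [exists 0|exists 1 => x [/andP[]]].
have s0 : 0 <= sup E by apply: ub_le_sup => //; exact: supE.2.
have s1 : sup E <= 1 by apply: ge_sup => [|x [/andP[]]//]; exists 0.
have [|d d0 H] := Ploc (sup E); first by rewrite s0.
have d2 : 0 < d / 2 by rewrite divr_gt0.
have [a [/andP[a0 a1] P0a] sa] := sup_adherent d2 supE.
have as' : a <= sup E by apply: ub_le_sup; [exact: supE.2|split=> //; rewrite a0].
have [b1|b1] := leP (sup E + d / 3) 1.
  have Eb : E (sup E + d / 3).
    split; first by lra.
    by apply: (Padd _ a) => //; [lra|apply: H => //; lra].
  have : sup E + d / 3 <= sup E by apply: ub_le_sup => //; exact: supE.2.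
  lra.
by apply: (Padd _ a) => //; apply: H => //; lra.
Qed.

End RealInduction.

Section Cone.
Context {R : realType} {X : normedModType R} (C : set X).
Hypothesis coneC : cone C.

Lemma cone0 : C 0.
Proof.
have [_ _ _ C0] := coneC.
by have : [set 0] (0 : X) by []; rewrite -C0 => -[].
Qed.

Lemma cone_scale (a : R) x : 0 <= a -> C x -> C (a *: x).
Proof.
have [_ _ CZ _] := coneC.
rewrite le_eqVlt => /predU1P[<- _|a0 Cx]; first by rewrite scale0r; exact: cone0.
by apply: (CZ a a0); exists x.
Qed.

Lemma coneD x y : C x -> C y -> C (x + y).
Proof.
have [_ Cconv _ _] := coneC.
move=> /mem_set Cx /mem_set Cy.
have half0 : 0 <= 2^-1 :> R by lra.
have half1 : 2^-1 <= 1 :> R by lra.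
have Cxy : C (2^-1 *: x + (1 - 2^-1) *: y).
  exact: (set_mem (Cconv x y (Itv01 half0 half1) Cx Cy)).
have H := cone_scale (ler0n R 2) Cxy.
suff -> : x + y = 2 *: (2^-1 *: x + (1 - 2^-1) *: y) by [].
rewrite (_ : 1 - 2^-1 = 2^-1 :> R); last by lra.
by rewrite scalerDr !scalerA mulfV// !scale1r.
Qed.

Lemma cone_pointed x : C x -> C (- x) -> x = 0.
Proof.
have [_ _ _ C0] := coneC.
by move=> Cx CNx; have : [set 0] x by rewrite -C0; split=> //; exists (- x); rewrite ?opprK.
Qed.

(** An interior point is an order unit: e + v / s stays in a ball around [e] inside [C]. The factor
    2 in [2 / d] keeps it strictly inside that ball. *)
Lemma cone_order_unit e : C° e ->
  exists2 m : R, 0 < m & forall (s : R) v, m * `|v| <= s -> C (s *: e + v).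
Proof.
move=> /nbhs_ballP[d /= d0 dC]; exists (2 / d); first by rewrite divr_gt0.
move=> s v sv.
have [->|v0] := eqVneq v 0.
  rewrite addr0; apply: cone_scale; last exact/dC/ballxx.
  by apply: le_trans sv; rewrite mulr_ge0// divr_ge0// ltW.
have nv : 0 < `|v| by rewrite normr_gt0.
have s0 : 0 < s by apply: lt_le_trans sv; rewrite mulr_gt0// divr_gt0.
have -> : s *: e + v = s *: (e + s^-1 *: v).
  by rewrite scalerDr scalerA mulfV ?gt_eqF// scale1r.
apply: (cone_scale (ltW s0)); apply: dC.
rewrite -ball_normE/= opprD addrA subrr sub0r normrN normrZ gtr0_norm ?invr_gt0//.
rewrite ltr_pdivrMl//; move: sv; rewrite mulrAC ler_pdivrMr// => sv.
move: nv; lra.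
Qed.

(** A substitute for normality of the cone, for comparison with multiples of [e] only. The point
    [- e] lies outside the closed set [C], and so does a [b]-ball around it; if |u| < s b, then u /
    s - e would be in this ball and in [C]. *)
Lemma cone_norm_lower e : C° e -> e != 0 ->
  exists2 b : R, 0 < b & forall (s : R) u, 0 <= s -> C (u - s *: e) -> s * b <= `|u|.
Proof.
move=> Ce e0.
have oC : open (~` C) by apply: closed_openC; case: coneC.
have nC : (~` C) (- e).
  move=> /= CNe; move/eqP: e0; apply; apply: cone_pointed => //.
  exact: interior_subset Ce.
have /nbhs_ballP[b /= b0 bC] := open_nbhs_nbhs (conj oC nC).
exists b => // s u; rewrite le_eqVlt => /predU1P[<- _|s0 Cu]; first by rewrite mul0r.
rewrite leNgt; apply/negP => us.
apply: (bC (s^-1 *: u - e)).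
  rewrite -ball_normE/= opprB addKr normrN normrZ gtr0_norm ?invr_gt0//.
  by rewrite ltr_pdivrMl.
have -> : s^-1 *: u - e = s^-1 *: (u - s *: e).
  by rewrite scalerBr scalerA mulVf ?gt_eqF// scale1r.
by apply: cone_scale => //; rewrite invr_ge0 ltW.
Qed.

(** A compact part of the interior has a uniform distance [d] to the complement of [C]; the [m]
    chosen makes m |e| < d. *)
Lemma compact_above e L : C° e -> compact L -> L `<=` C° ->
  exists2 m : R, 0 < m & forall w, L w -> C (w - m *: e).
Proof.
move=> Ce cL LC.
(* A radius of a ball inside [C], chosen at each point of [L]; the value 1 elsewhere is a dummy. *)
pose rho x := match pselect (L x) with
  | left Lx => projT1 (cid2 ((nbhs_ballP _ _).1 (LC _ Lx))) | right _ => 1 end.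
have rhoP x : L x -> 0 < rho x /\ ball x (rho x) `<=` C.
  by rewrite /rho; case: pselect => // Lx _; case: cid2.
have [d d0 H] := lebesgue_number cL (fun x Lx => (rhoP x Lx).1).
have e1 : 0 < `|e| + 1 by rewrite ltr_wpDl.
have m0 : 0 < d / (2 * (`|e| + 1)) by rewrite divr_gt0// mulr_gt0.
exists (d / (2 * (`|e| + 1))) => // w Lw.
have [a [La _ [_ Ha]]] := H _ Lw.
apply: (rhoP _ La).2; rewrite -ball_normE/= distrC; apply: Ha.
rewrite addrC addKr normrN normrZ gtr0_norm// mulrAC ltr_pdivrMr ?mulr_gt0//.
have := normr_ge0 e; move: d0; nra.
Qed.

Lemma cone_closed_e e x : (forall s : R, 0 < s -> C (x + s *: e)) -> C x.
Proof.
have [cC _ _ _] := coneC => H; apply: cC => B /nbhs_ballP[d /= d0 dB].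
have e1 : 0 < `|e| + 1 by rewrite ltr_wpDl.
have s0 : 0 < d / (`|e| + 1) by rewrite divr_gt0.
exists (x + (d / (`|e| + 1)) *: e); split; first exact: H.
apply: dB; rewrite -ball_normE/= opprD addrA subrr sub0r normrN normrZ gtr0_norm//.
by rewrite mulrAC ltr_pdivrMr// ltr_pM2l// ltrDl.
Qed.

(** A mean value inequality for the cone order. The slack [eta * (b - a)] in direction [e] absorbs
    the first-order error by the order-unit property, and closedness of [C] lets [eta] tend to 0. *)
Lemma cone_increment e (phi : R -> X) : C° e ->
  (forall t : R, 0 <= t <= 1 -> differentiable phi t /\ C ('d phi t 1)) ->
  C (phi 1 - phi 0).
Proof.
move=> Ce phiC; have [m m0 HC] := cone_order_unit Ce.
apply: (@cone_closed_e e) => eta eta0.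
pose P a b := C (phi b - phi a + (eta * (b - a)) *: e).
suff : P 0 1 by rewrite /P subr0 mulr1.
apply: interval_additive => [a b c ab bc Pab Pbc|t t01].
  rewrite /P; suff -> : phi c - phi a + (eta * (c - a)) *: e =
      (phi c - phi b + (eta * (c - b)) *: e) +
      (phi b - phi a + (eta * (b - a)) *: e) by exact: coneD.
  by rewrite addrACA subrKA -scalerDl -mulrDr subrKA.
have [/diff_locallyP[_ /eqaddoP dphi] Cphi] := phiC t t01.
have em : 0 < eta / m by rewrite divr_gt0.
have /nbhs_normP[d /= d0 dH] := dphi _ em.
have {}dH s : `|s - t| < d ->
    `|phi s - phi t - (s - t) *: 'd phi t 1| <= eta / m * `|s - t|.
  move=> st; have /dH : `|0 - (s - t)| < d by rewrite sub0r normrN.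
  have -> : (s - t) *: 'd phi t 1 = 'd phi t (s - t).
    by rewrite -linearZZ /= -[_ *: 1]/(_ * 1) mulr1.
  by rewrite /= !fctE/= subrK opprD addrA.
(* Since [t] lies between [a] and [b], the two expansion errors at [t] are proportional to t - a and
   b - t, which add up to b - a. *)
exists d => // a b a0 at' tb b1 bad.
have Ha : `|phi a - phi t - (a - t) *: 'd phi t 1| <= eta / m * (t - a).
  have E : `|a - t| = t - a by rewrite ler0_norm ?opprB// subr_le0.
  by rewrite -[in leRHS]E; apply: dH; rewrite E; lra.
have Hb : `|phi b - phi t - (b - t) *: 'd phi t 1| <= eta / m * (b - t).
  have E : `|b - t| = b - t by rewrite ger0_norm// subr_ge0.
  by rewrite -[in leRHS]E; apply: dH; rewrite E; lra.
rewrite /P.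
set ra := phi a - _ - _ in Ha; set rb := phi b - _ - _ in Hb.
have -> : phi b - phi a = (b - a) *: 'd phi t 1 + (rb - ra).
  have -> : phi b - phi a = (phi b - phi t) - (phi a - phi t).
    by rewrite opprB addrA subrK.
  rewrite -[phi b - phi t](subrK ((b - t) *: 'd phi t 1)) -/rb.
  rewrite -[phi a - phi t](subrK ((a - t) *: 'd phi t 1)) -/ra.
  rewrite opprD addrACA -scalerBl [LHS]addrC.
  by congr (_ *: _ + _); ring.
rewrite -addrA; apply: coneD.
  by apply: cone_scale => //; lra.
rewrite addrC; apply: HC.
have : `|rb - ra| <= eta / m * (b - a).
  rewrite (le_trans (ler_normB _ _))// (_ : b - a = (b - t) + (t - a)); last by ring.
  by rewrite mulrDr lerD.
by rewrite mulrAC ler_pdivlMr// mulrC.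
Qed.

End Cone.

(** * A robustly invariant set of vectors around the interior direction *)

Section NarrowCone.
Context {R : realType} {X : completeNormedModType R}.
Variables (C : set X) (e : X) (h : X -> X) (K : set X).
Hypothesis coneC : cone C.
Hypothesis Ce : C° e.
Hypothesis e0 : e != 0.
Hypothesis hc : compact_map_on setT h.
Hypothesis hC1 : C1_map h.
Hypothesis hpos : forall x, strongly_positive C ('d h x).
Hypothesis cK : compact K.

(** The lower bound is imposed on the images of [v], not on [v] itself: images of bounded sets are
    relatively compact, which makes strong positivity uniform on them. *)
Definition narrow (rho : R) : set X :=
  [set v | forall y, K y -> C ('d h y v - (rho * `|v|) *: e)].

Lemma diff_positive y v : C v -> C ('d h y v).
Proof.
move=> Cv; have [->|v0] := eqVneq v 0; first by rewrite linear0; exact: cone0.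
have := @hpos y v; rewrite /cone_lt /cone_ll !subr0 => H.
by apply: interior_subset; apply: H; split=> //; exact/eqP.
Qed.

Lemma diff_bounded : exists2 B : R, 0 < B &
  forall y v, K y -> `|'d h y v| <= B * `|v|.
Proof.
have := diff_family_precompact hc hC1 cK.
rewrite precompactE => /compact_bounded /bounded_setP[M HM].
have M0 : 0 < Num.max M 1 by rewrite lt_max ltr01 orbT.
exists (Num.max M 1) => // y v Ky.
have [->|v0] := eqVneq v 0; first by rewrite linear0 !normr0 mulr0.
have nv : 0 < `|v| by rewrite normr_gt0.
rewrite -ler_pdivrMr//.
have -> : `|'d h y v| / `|v| = `|'d h y (`|v|^-1 *: v)|.
  by rewrite linearZZ normrZ normfV normr_id mulrC.
rewrite le_max HM//; apply: subset_closure; exists (y, `|v|^-1 *: v) => //=.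
by split=> //; rewrite normrZ normfV normr_id mulVf// gt_eqF.
Qed.

Lemma diff_unit_lower : exists2 c : R, 0 < c &
  forall y, K y -> C ('d h y e - c *: e).
Proof.
have [||c c0 H] := compact_above Ce (L := (fun y => 'd h y e) @` K).
- apply: continuous_compact => //; apply: continuous_subspaceT.
  exact: diff_continuous_base.
- move=> _ [y Ky <-]; have := @hpos y e; rewrite /cone_lt /cone_ll !subr0.
  by apply; split; [exact: interior_subset|exact/eqP].
by exists c => // y Ky; apply: H; exists y.
Qed.

(* The image of the unit ball under all the derivatives at points of [K] is
   relatively compact, hence so is its part in the cone away from the origin. *)
Lemma diff_image_lower (a : R) : 0 < a -> exists2 m : R, 0 < m &
  forall y z v, K y -> K z -> C ('d h z v) -> a * `|v| <= `|'d h z v| ->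
    C ('d h y ('d h z v) - (m * `|v|) *: e).
Proof.
move=> a0.
pose D := [set 'd h (p.1) (p.2) | p in [set p : X * X | K p.1 /\ `|p.2| <= 1]].
pose W := closure D `&` (C `&` [set w : X | a <= `|w|]).
have cW : compact W.
  apply: compact_closedI.
    by rewrite -precompactE; exact: diff_family_precompact.
  apply: closedI; first by case: coneC.
  apply: (@closed_comp _ _ (fun w : X => `|w|) [set x | a <= x]).
    by move=> w _; exact: norm_continuous.
  exact: closed_ge.
have [||m m0 H] := compact_above Ce
    (L := (fun p : X * X => 'd h (p.1) (p.2)) @` (K `*` W)).
- apply: continuous_compact; last exact: compact_setX.
  by apply: continuous_subspaceT; exact: diff_continuous2.
- move=> _ [[y w] /= [Ky [_ [Cw aw]]] <-].
  have := @hpos y w; rewrite /cone_lt /cone_ll !subr0.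
  apply; split=> // w0; move: aw; rewrite /= w0 normr0; lra.
exists m => // y z v Ky Kz Cv av.
have [->|v0] := eqVneq v 0.
  by rewrite !linear0 normr0 mulr0 scale0r subrr; exact: cone0.
have nv : 0 < `|v| by rewrite normr_gt0.
have -> : 'd h y ('d h z v) - (m * `|v|) *: e =
    `|v| *: ('d h y ('d h z (`|v|^-1 *: v)) - m *: e).
  rewrite !(linearZZ (diff _ _)) scalerBr !scalerA mulfV ?gt_eqF// scale1r.
  by rewrite (mulrC m).
apply: cone_scale => //; apply: H; exists (y, 'd h z (`|v|^-1 *: v)) => //=.
split=> //; split.
  apply: subset_closure; exists (z, `|v|^-1 *: v) => //=; split=> //.
  by rewrite normrZ normfV normr_id mulVf// gt_eqF.
rewrite linearZZ; split; first by apply: cone_scale => //; rewrite invr_ge0.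
by rewrite /= normrZ normfV normr_id mulrC ler_pdivlMr.
Qed.

(** For narrow [v] the image [w'] under 'd h z satisfies the defining inequality with [2 * rho] in
    place of [rho]. The spare half pays for replacing [w'] by a nearby [w]. *)
Lemma narrow_cone : exists rho k r : R, [/\ 0 < rho, 0 < k, 0 < r,
  (forall p, `|p| <= r -> narrow rho (e + p)) &
  (forall z v w, K z -> narrow rho v -> `|w - 'd h z v| <= k * `|v| ->
     narrow rho w)].
Proof.
have [B B0 HB] := diff_bounded.
have [c c0 Hc] := diff_unit_lower.
have [m m0 Hm] := cone_order_unit coneC Ce.
have [b b0 Hb] := cone_norm_lower coneC Ce e0.
have [|u u0 Hu] := @diff_image_lower (c / 2); first by rewrite divr_gt0.
(* With m B r = c / 2, a perturbation of [e] by at most [r] uses half of the lower bound [c]. The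
   first bound on [rho] fits rho (|e| + r) into the other half; the second is for the large-image
   case below. *)
pose r := c / (2 * B * m).
have r0 : 0 < r by rewrite divr_gt0// !mulr_gt0.
have er : 0 < 2 * (`|e| + r) by rewrite mulr_gt0// ltr_wpDl.
pose rho := Num.min (c / (2 * (`|e| + r))) (u / (2 * B)).
have rho0 : 0 < rho by rewrite lt_min !divr_gt0// mulr_gt0.
have rho1 : rho * (`|e| + r) <= c / 2.
  have : rho <= c / (2 * (`|e| + r)) by rewrite ge_min lexx.
  by rewrite ler_pdivlMr// => H; rewrite ler_pdivlMr// -mulrA (mulrC _ 2).
have rho2 : rho * (2 * B) <= u.
  have : rho <= u / (2 * B) by rewrite ge_min lexx orbT.
  by rewrite ler_pdivlMr// mulr_gt0.
(* Passing from [w'] to [w] costs m B k |v| in the image and rho k |v| in the norm term; the reserve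
   rho |w'| is at least rho^2 b |v|. *)
pose k := rho ^+ 2 * b / (m * B + rho).
have mBr : 0 < m * B + rho by rewrite addr_gt0// mulr_gt0.
have k0 : 0 < k by rewrite divr_gt0// mulr_gt0// exprn_gt0.
have kE : k * (m * B + rho) = rho ^+ 2 * b by rewrite /k divfK// gt_eqF.
exists rho, k, r; split=> //.
  move=> p pr y Ky; rewrite linearD.
  have -> : 'd h y e + 'd h y p - (rho * `|e + p|) *: e =
     ('d h y e - c *: e) + ((c - rho * `|e + p|) *: e + 'd h y p).
    by rewrite scalerBl [RHS]addrA subrKA addrAC.
  apply: coneD => //; first exact: Hc.
  apply: Hm; apply: (@le_trans _ _ (c / 2)).
    have : m * `|'d h y p| <= m * (B * r).
      by rewrite ler_pM2l// (le_trans (HB _ _ Ky))// ler_pM2l.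
    move=> /le_trans; apply; rewrite /r.
    rewrite (_ : m * _ = c / 2)//; field.
    by rewrite !gt_eqF.
  have : rho * `|e + p| <= rho * (`|e| + r).
    by rewrite ler_pM2l// (le_trans (ler_normD _ _))// lerD2l.
  lra.
move=> z v w Kz nv wv y Ky.
have Cw := nv z Kz; set w' := 'd h z v in wv Cw.
have w'lo : rho * `|v| * b <= `|w'| by apply: Hb Cw; rewrite mulr_ge0// ltW.
have Cw' : C w'.
  rewrite -(subrK ((rho * `|v|) *: e) w'); apply: coneD => //.
  apply: cone_scale => //; last exact: interior_subset.
  by rewrite mulr_ge0// ltW.
(* If |w'| is at most (c / 2) |v|, the bound w' >= rho |v| e is pushed forward by 'd h y e >= c e.
   Otherwise [w'] is large enough for [diff_image_lower], whose constant [u] dominates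
   [2 * rho * B]. *)
have two : C ('d h y w' - (2 * rho * `|w'|) *: e).
  have [w's|w'l] := leP `|w'| (c / 2 * `|v|).
    rewrite (_ : _ - _ = ('d h y w' - (rho * `|v|) *: 'd h y e) +
      ((rho * `|v|) *: ('d h y e - c *: e) +
       (rho * `|v| * c - 2 * rho * `|w'|) *: e)).
      apply: coneD => //.
        rewrite -linearZZ -linearB; apply: diff_positive; exact: nv.
      apply: coneD => //; apply: cone_scale => //; last exact: interior_subset.
      - by rewrite mulr_ge0// ltW.
      - exact: Hc.
      rewrite subr_ge0; move: w's rho0; nra.
    by rewrite scalerBr scalerA scalerBl addrA addrA addrA !subrK.
  have := Hu y z v Ky Kz Cw' (ltW w'l).
  move=> H; rewrite -(subrKA ((u * `|v|) *: e)); apply: coneD => //.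
  rewrite -scalerBl; apply: cone_scale => //; last exact: interior_subset.
  rewrite subr_ge0; have := HB z v Kz; rewrite -/w' => wB.
  apply: (@le_trans _ _ (2 * rho * (B * `|v|))).
    by rewrite ler_pM2l// mulr_gt0.
  rewrite mulrA ler_wpM2r// -mulrA mulrCA //.
have nw : `|w| <= `|w'| + k * `|v|.
  by rewrite -(subrK w' w) (le_trans (ler_normD _ _))// addrC lerD2l.
have -> : 'd h y w - (rho * `|w|) *: e = ('d h y w' - (2 * rho * `|w'|) *: e) +
   ((2 * rho * `|w'| - rho * `|w|) *: e + 'd h y (w - w')).
  by rewrite linearB scalerBl [RHS]addrA subrKA [RHS]addrC subrKA.
apply: coneD => //; apply: Hm.
have : m * `|'d h y (w - w')| <= m * (B * (k * `|v|)).
  by rewrite ler_pM2l// (le_trans (HB _ _ Ky))// ler_pM2l.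
move=> /le_trans; apply.
have h1 : rho * `|w| <= rho * (`|w'| + k * `|v|) by rewrite ler_pM2l.
have h2 : rho * (rho * `|v| * b) <= rho * `|w'| by rewrite ler_pM2l.
have h3 : rho * (rho * `|v| * b) = k * (m * B + rho) * `|v| by rewrite kE; ring.
move: h1 h2; rewrite h3.
have -> : k * (m * B + rho) * `|v| = m * (B * (k * `|v|)) + rho * (k * `|v|) by ring.
rewrite mulrDr; lra.
Qed.

End NarrowCone.

(** * Exponents along segments *)

Section Integration.
Context {R : realType}.
Local Notation mu := (@lebesgue_measure R).

Lemma continuous_antiderivative (g : R -> R) : continuous g ->
  exists Phi : R -> R,
    (forall t : R, 0 <= t <= 1 -> derivable Phi t 1 /\ derive1 Phi t = g t) /\
    (\int[mu]_(x in `[0%R, 1%R]) (g x)%:E = (Phi 1 - Phi 0)%:E)%E.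
Proof.
move=> cg.
(* Starting the integral at -1 makes 0 an interior point, so that [Phi] has two-sided derivatives on
   all of [0, 1]. *)
pose Phi (x : R) := (\int[mu]_(t in `[(-1)%R, x]) (g t))%R.
have dPhi t : 0 <= t <= 1 -> derivable Phi t 1 /\ derive1 Phi t = g t.
  move=> t01; apply: (@continuous_FTC1_closed _ g (-1) t 2); [lra| |lra|exact: cg].
  apply: continuous_compact_integrable; first exact: segment_compact.
  exact: continuous_subspaceT.
exists Phi; split=> //.
have cPhi t : 0 <= t <= 1 -> {for t, continuous Phi}.
  move=> /dPhi[dt _]; apply: differentiable_continuous.
  exact/derivable1_diffP.
rewrite EFinB; apply: continuous_FTC2 => //.
- exact: continuous_subspaceT.
- split.
  + by move=> t; rewrite in_itv/= => t01; apply: (dPhi t _).1; lra.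
  + by apply: cvg_at_right_filter; apply: cPhi; rewrite lexx ler01.
  + by apply: cvg_at_left_filter; apply: cPhi; rewrite lexx ler01.
- by move=> t; rewrite in_itv/= => t01; apply: (dPhi t _).2; lra.
Qed.

(** By Fatou's lemma the lower limit of the [g n] has integral at most [M], hence is finite almost
    everywhere, whereas it is infinite on the set in question. *)
Lemma blowup_negligible (g : nat -> R -> R) (M : R) :
  (forall n, continuous (g n)) -> (forall n t, 0 <= g n t) ->
  (forall n, (\int[mu]_(x in `[0%R, 1%R]) (g n x)%:E <= M%:E)%E) ->
  mu.-negligible [set t | 0 <= t <= 1 /\
    forall B : R, exists N, forall n, (N <= n)%N -> B <= g n t].
Proof.
move=> cg g0 gM.
pose D : set R := `[0%R, 1%R]%classic.
have mD : measurable D by exact: measurable_itv.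
pose f n (t : R) := (g n t)%:E.
have mf n : measurable_fun D (f n).
  apply/measurable_EFinP; apply: measurable_funTS.
  exact: continuous_measurable_fun.
have f0 n t : D t -> (0 <= f n t)%E by rewrite lee_fin.
have ml : measurable_fun D (fun t => limn_einf (f ^~ t)).
  apply: (emeasurable_fun_cvg (fun n t => einfs (f ^~ t) n)) => [n|t Dt].
    exact: measurable_fun_einfs.
  by rewrite limn_einf_lim; exact: is_cvg_einfs.
have l0 t : (0 <= limn_einf (f ^~ t))%E.
  rewrite limn_einf_lim; apply: lime_ge; first exact: is_cvg_einfs.
  apply: nearW => n; apply: le_ereal_inf_tmp => _ [k _ <-].
  by rewrite lee_fin.
have intl : (\int[mu]_(t in D) limn_einf (f ^~ t) <= M%:E)%E.
  apply: (le_trans (fatou mu mD mf f0)).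
  rewrite limn_einf_lim; apply: lime_le; first exact: is_cvg_einfs.
  apply: nearW => n; apply: ge_ereal_inf; exists (\int[mu]_(x in D) f n x)%E.
    by exists n => /=.
  exact: gM.
have il : mu.-integrable D (fun t => limn_einf (f ^~ t)).
  apply/integrableP; split=> //; apply: (le_lt_trans _ (ltry M)).
  apply: le_trans intl; rewrite le_eqVlt; apply/orP; left; apply/eqP.
  by apply: eq_integral => t _; rewrite gee0_abs.
have := @integrable_ae _ _ _ mu D mD _ il.
apply: negligibleS => t [t01 gt] /= fin.
have Dt : D t by rewrite /D/= in_itv/=.
have {fin} := fin Dt.
suff -> : limn_einf (f ^~ t) = +oo%E by [].
apply/eqyP => B B0.
have [N HN] := gt B.
rewrite limn_einf_lim; apply: lime_ge; first exact: is_cvg_einfs.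
exists N => // n /= Nn; apply: le_ereal_inf_tmp => _ [k /= nk <-].
by rewrite lee_fin HN// (leq_trans Nn).
Qed.

End Integration.

Section Lyapunov.
Context {R : realType} {X : normedModType R}.

Lemma limn_einfE (u : (\bar R)^nat) : limn_einf u = ereal_sup (range (einfs u)).
Proof. by rewrite limn_einf_lim; apply/cvg_lim => //; exact: cvg_einfs_sup. Qed.

(** A countable form without logarithm or lower limit, from which both the growth estimate and Borel
    measurability are read off. *)
Lemma lambda_max_gt0P (h : X -> X) x : (0 < lambda_max x h)%E <->
  exists k m : nat, forall n, (m < n)%N ->
    ((expR (n%:R / k.+1%:R))%:E < opnorm ('d (iter n h) x))%E.
Proof.
set a := fun n => opnorm ('d (iter n h) x).
have a0 n : (0 <= a n)%E.
  by apply: le_trans (opnorm_ub _ (v := 0) _); rewrite ?normr0// lee_fin.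
(* The case n = 0 is excluded because the inverse of 0 is 0 here. The values 0 and +oo of [a n] are
   treated apart, with logarithms -oo and +oo. *)
have aP (c : R) n : (0 < n)%N ->
    ((expR (n%:R * c))%:E < a n)%E = (c%:E < lne (a n) * (n%:R^-1)%:E)%E.
  move=> n0; have n0' : 0 < n%:R^-1 :> R by rewrite invr_gt0 ltr0n.
  have := a0 n; case: (a n) => [r| |]//=.
  - rewrite lee_fin le_eqVlt => /predU1P[<-|r0].
      rewrite lexx lte_fin ltNge expR_ge0/=.
      by rewrite mulNyr gtr0_sg// mul1e ltNge leNye.
    rewrite leNgt r0/= -EFinM !lte_fin ltr_pdivlMr ?ltr0n// (mulrC c).
    by rewrite -{1}(lnK r0) ltr_expR.
  - by rewrite mulyr gtr0_sg// mul1e !ltry.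
rewrite /lambda_max limn_einfE; split.
  move=> /ereal_sup_gt[_ [m _ <-]] im.
  have [k km] : exists k, ((k.+1%:R^-1)%:E <
      einfs (fun n => lne (a n) * (n%:R^-1)%:E) m)%E.
    case: (einfs _ m) im => [r| |]//; last by exists 0%N; rewrite ltry.
    rewrite lte_fin => r0; near \oo => k; exists k; rewrite lte_fin.
    by near: k; exact: near_infty_natSinv_lt (PosNum r0).
  exists k, m => n mn.
  rewrite aP; last by apply: leq_ltn_trans mn.
  by apply: (lt_le_trans km); apply: ereal_inf_lbound; exists n => //=; exact: ltnW.
move=> [k [m H]].
apply: (@lt_le_trans _ _ (k.+1%:R^-1)%:E); first by rewrite lte_fin invr_gt0 ltr0n.
(* The tail starts at [m.+1] because the inequality is known only for [n > m]. *)
apply: ereal_sup_ge; exists (einfs (fun n => lne (a n) * (n%:R^-1)%:E)%E m.+1).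
  by exists m.+1.
apply: le_ereal_inf_tmp => _ [n /= mn <-]; apply/ltW.
by rewrite -aP ?H//; apply: leq_ltn_trans mn.
Unshelve. all: by end_near. Qed.

End Lyapunov.

Section Segment.
Context {R : realType} {X : completeNormedModType R}.
Variables (C : set X) (e : X) (h : X -> X) (K : set X).
Hypothesis coneC : cone C.
Hypothesis Ce : C° e.
Hypothesis e0 : e != 0.
Hypothesis hc : compact_map_on setT h.
Hypothesis hC1 : C1_map h.
Hypothesis hpos : forall x, strongly_positive C ('d h x).
Hypothesis cK : compact K.
Hypothesis K0 : K !=set0.
Local Notation mu := (@lebesgue_measure R).
Local Notation narrow := (narrow C e h K).

Lemma narrow_scale (rho a : R) v : 0 <= a -> narrow rho v -> narrow rho (a *: v).
Proof.
move=> a0 nv y Ky; rewrite linearZZ normrZ ger0_norm// mulrCA -scalerA -scalerBr.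
by apply: cone_scale => //; exact: nv.
Qed.

(* Both [e + r v] and [e - r v] are narrow, and their images sum to [2 P e]: a
   sum of narrow vectors is bounded below by the sum of the norms. *)
Lemma narrow_dominates (rho r : R) (P : {linear X -> X}) : 0 < rho -> 0 < r ->
  (forall p, `|p| <= r -> narrow rho (e + p)) ->
  (forall v, narrow rho v -> narrow rho (P v)) ->
  forall B b : R, 0 < b ->
  (forall y v, K y -> `|'d h y v| <= B * `|v|) ->
  (forall (s : R) u, 0 <= s -> C (u - s *: e) -> s * b <= `|u|) ->
  forall v, `|v| <= 1 -> `|P v| <= B / (rho * b * r) * `|P e|.
Proof.
move=> rho0 r0 Hr HP B b b0 HB Hb v v1; have [y Ky] := K0.
have rv : `|r *: v| <= r by rewrite normrZ gtr0_norm// ler_piMr// ltW.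
have rNv : `|- (r *: v)| <= r by rewrite normrN.
have h1 := HP _ (Hr _ rv) y Ky.
have h2 := HP _ (Hr _ rNv) y Ky.
set a := P (e + r *: v) in h1; set a' := P (e + - (r *: v)) in h2.
have aa' : a + a' = 2 *: P e.
  by rewrite -linearD addrACA subrr addr0 scaler_nat -linearMn mulr2n.
have := coneD coneC h1 h2.
rewrite addrACA -opprD -scalerDl -mulrDr -linearD aa' => Caa'.
have aa'0 : 0 <= rho * (`|a| + `|a'|) by rewrite mulr_ge0 ?addr_ge0// ltW.
have H := le_trans (Hb _ _ aa'0 Caa') (HB _ _ Ky).
rewrite normrZ gtr0_norm// in H.
have : 2 * r * `|P v| <= `|a| + `|a'|.
  have -> : 2 * r * `|P v| = `|a - a'|.
    rewrite -linearB opprD addrACA subrr add0r opprK -scalerDl linearZZ normrZ.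
    by rewrite gtr0_norm ?addr_gt0//; congr (_ * _); ring.
  exact: ler_normB.
move=> H2.
have rb : 0 < rho * b by rewrite mulr_gt0.
rewrite mulrAC ler_pdivlMr ?mulr_gt0//.
have : rho * b * (2 * r * `|P v|) <= rho * b * (`|a| + `|a'|) by rewrite ler_pM2l.
move: H; lra.
Qed.

(** The tolerance [k] depends only on the unperturbed data [h], [K], [e], so it is available before
    [f] is chosen. Narrowness of the propagated vectors follows by induction on [n]. *)
Lemma segment_negligible : exists2 k : R, 0 < k & forall (f : X -> X) (s M : R) x0,
  C1_map f -> 0 < s ->
  (forall (t : R) n, 0 <= t <= 1 -> exists2 z, K z & forall v,
    `|'d f (iter n f (x0 + t *: (s *: e))) v - 'd h z v| <= k * `|v|) ->
  (forall (t : R) n, 0 <= t <= 1 -> `|iter n f (x0 + t *: (s *: e))| <= M) ->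
  mu.-negligible [set t : R | 0 <= t <= 1 /\
    (0 < lambda_max (x0 + t *: (s *: e))%R f)%E].
Proof.
have [rho [k [r [rho0 k0 r0 Hr Hinv]]]] :=
  narrow_cone coneC Ce e0 hc hC1 hpos cK.
have [B B0 HB] := diff_bounded hc hC1 cK.
have [b b0 Hb] := cone_norm_lower coneC Ce e0.
exists k => // f s M x0 fC s0 Hz HM.
pose p (t : R) := x0 + t *: (s *: e).
have Pnarrow (t : R) n v : 0 <= t <= 1 -> narrow rho v ->
    narrow rho ('d (iter n f) (p t) v).
  move=> t01 nv; elim: n => [|n IH]; first by rewrite diff_iter0.
  rewrite diff_iterS//; have [z Kz zk] := Hz t n t01.
  exact: Hinv Kz IH (zk _).
have se : narrow rho (s *: e).
  by apply: narrow_scale; [exact: ltW|have := Hr 0; rewrite normr0 addr0; apply; exact: ltW].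
have dl (t : R) : differentiable (fun t : R => t *: (s *: e)) t.
  exact: (@differentiableZl _ _ _ id).
have dc (t : R) : differentiable (cst x0 : R -> X) t by exact: differentiable_cst.
have pd t : differentiable p t by exact: (differentiableD (dc t) (dl t)).
have dp t : 'd p t 1 = s *: e.
  rewrite (diffD (dc t) (dl t)) diff_cst (@diffZl _ _ _ id) // diff_val.
  by rewrite /= scale1r; exact: add0r.
pose g n (t : R) := `|'d (iter n f) (p t) (s *: e)|.
have cp : continuous p by move=> t; exact: differentiable_continuous.
have cg n : continuous (g n).
  move=> t; apply: (@continuous_comp _ _ _ (fun t => 'd (iter n f) (p t) (s *: e))).
    apply: (@continuous_comp _ _ _ p (fun x => 'd (iter n f) x (s *: e))).
      exact: cp.
    exact: diff_iter_continuous.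
  exact: norm_continuous.
have [y Ky] := K0.
(* The endpoints of the image segment differ by at most [2 * M], [B] bounds the derivative applied
   to this difference, and [rho * b] comes from comparison with multiples of [e]. *)
pose M' := B * (2 * M) / (rho * b).
have rb : 0 < rho * b by rewrite mulr_gt0.
have intg n : (\int[mu]_(x in `[0%R, 1%R]) (g n x)%:E <= M'%:E)%E.
  have [Phi [dPhi ->]] := continuous_antiderivative (cg n).
  rewrite lee_fin ler_pdivlMr//.
  pose G (t : R) := iter n f (p t).
  have dG t : differentiable G t.
    apply: differentiable_comp => //; exact: C1_iter_differentiable.
  have dT x : differentiable ('d h y) x.
    by apply: linear_differentiable; apply: diff_continuous; exact: hC1.1.
  (* Its derivative at [t] is 'd h y w - rho |w| e with w the propagated vector of norm [g n t]; it
     lies in [C] because w is narrow. *)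
  pose phi (t : R) := 'd h y (G t) - (rho * Phi t) *: e.
  have dphi (t : R) : 0 <= t <= 1 -> differentiable phi t /\ C ('d phi t 1).
    move=> t01; have [/derivable1_diffP dP PE] := dPhi t t01.
    have d1 := differentiable_comp (dG t) (dT (G t)).
    have dr : differentiable (fun t => rho * Phi t) t.
      by apply: differentiableM => //; exact: differentiable_cst.
    have d2 := differentiableZl e dr.
    split; first exact: (differentiableB d1 d2).
    have -> : 'd phi t 1 = 'd h y ('d (iter n f) (p t) (s *: e)) -
        (rho * `|'d (iter n f) (p t) (s *: e)|) *: e.
      rewrite (diffB d1 d2) -[LHS]/('d ('d h y \o G) t 1 -
        'd (fun t => (rho * Phi t) *: e) t 1); congr (_ - _).
        rewrite (diff_comp (dG t) (dT _)) diff_lin; last first.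
          exact: diff_continuous (hC1.1 y).
        rewrite /= (diff_comp (pd t)) /= ?dp//; exact: C1_iter_differentiable.
      rewrite (diffZl e dr); congr (_ *: _).
      rewrite -deriveE// deriveMl; last exact/derivable1_diffP.
      by rewrite -derive1E PE.
    exact: Pnarrow.
  have := cone_increment coneC Ce dphi.
  have -> : phi 1 - phi 0 =
      'd h y (G 1 - G 0) - (rho * (Phi 1 - Phi 0)) *: e.
    rewrite /phi (linearB (diff _ _)) mulrBr scalerBl !opprB addrACA [RHS]addrACA.
    by rewrite [- _ - _ in RHS]addrC.
  move=> Cphi.
  have G2M : `|'d h y (G 1 - G 0)| <= B * (2 * M).
    rewrite (le_trans (HB _ _ Ky))// ler_pM2l// (le_trans (ler_normB _ _))//.
    by rewrite mulr2n mulrDl mul1r lerD// HM// lexx ler01.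
  have [Phi01|Phi01] := leP 0 (Phi 1 - Phi 0).
    have rP : 0 <= rho * (Phi 1 - Phi 0) by rewrite mulr_ge0// ltW.
    by have := le_trans (Hb _ _ rP Cphi) G2M; rewrite mulrAC mulrC.
  apply: le_trans (le_trans (normr_ge0 _) G2M).
  by rewrite mulr_le0_ge0// ltW.
have g0 n (t : R) : 0 <= g n t by rewrite normr_ge0.
apply: negligibleS (blowup_negligible cg g0 intg) => t [t01 /lambda_max_gt0P[j [m Hj]]].
split=> // Bd.
(* Exponential growth of the full operator norm is thereby transferred to the single direction
   [e]. *)
have dom n : (opnorm ('d (iter n f) (p t)) <=
    (B / (rho * b * r) * `|'d (iter n f) (p t) e|)%:E)%E.
  apply: opnorm_le => v v1; apply: narrow_dominates => // w.
  exact: Pnarrow.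
pose H := B / (rho * b * r).
have H0 : 0 < H by rewrite divr_gt0// mulr_gt0.
(* From this index on, already 1 + n / (j + 1), a lower bound of the exponential, exceeds the
   required multiple of [Bd]. *)
pose N := Num.bound (`|Bd| * H / s * j.+1%:R).
exists (maxn m.+1 N) => n; rewrite geq_max => /andP[mn Nn].
have := lt_le_trans (Hj n mn) (dom n).
rewrite lte_fin -/H => /ltW He.
rewrite /g linearZZ normrZ gtr0_norm// -ler_pdivrMl// -(ler_pM2l H0).
apply: le_trans He; apply: le_trans (expR_ge1Dx _).
have : `|Bd| * H / s * j.+1%:R <= n%:R.
  apply: le_trans (_ : N%:R <= _); last by rewrite ler_nat.
  apply/ltW/archi_boundP; apply: mulr_ge0; last by rewrite ler0n.
  by apply: mulr_ge0; [apply: mulr_ge0; [|exact: ltW]|rewrite invr_ge0 ltW].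
rewrite -ler_pdivlMr ?ltr0n// => Hn.
have : H * (s^-1 * Bd) <= `|Bd| * H / s.
  have -> : `|Bd| * H / s = H * (s^-1 * `|Bd|) by ring.
  by rewrite ler_pM2l// ler_pM2l ?invr_gt0// ler_norm.
by move=> HB1; rewrite (le_trans (le_trans HB1 Hn))// lerDr ler01.
Qed.

End Segment.

(** * Perturbed dynamics *)

Section Attraction.
Context {R : realType} {X : normedModType R}.
Implicit Types (h : X -> X) (A S : set X).

Lemma attracts_near h A S (eta : R) : attracts h A S -> 0 < eta ->
  exists N, forall n x, (N <= n)%N -> S x ->
    exists2 a, A a & `|iter n h x - a| < eta.
Proof.
move=> att eta0; have := att _ (nbhs0_lte eta0).
move=> [N _ HN]; exists N => n x Nn Sx.
have := HN n Nn; rewrite /= gt_max => /andP[_ H].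
have : (edist_inf A (iter n h x) < eta%:E)%E.
  by apply: le_lt_trans H; apply: ereal_sup_ubound; exists x.
move=> /ereal_inf_lt[_ [a Aa <-]] d; exists a => //.
have : (edist (iter n h x, a) \is a fin_num).
  by rewrite ge0_fin_numE ?edist_ge0//; apply: lt_trans d (ltry _).
move=> fd; have := edist_lt_ball d.
by rewrite -ball_normE.
Qed.

Lemma compact_neighborhood (A : set X) c (r : R) : compact A -> A `<=` ball c r ->
  exists2 d : R, 0 < d & forall a x, A a -> `|x - a| < d -> ball c r x.
Proof.
move=> cA Ar; pose rho a := r - `|a - c|.
have rho0 a : A a -> 0 < rho a.
  by move=> /Ar; rewrite -ball_normE/= distrC subr_gt0.
have [d d0 H] := lebesgue_number cA rho0.
exists d => // a x Aa xa; have [a' [_ _ [_ /(_ x xa) xa']]] := H a Aa.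
move: xa'; rewrite /rho => xa'; rewrite -ball_normE/= distrC.
rewrite -(subrKA a') (le_lt_trans (ler_normD _ _))//; lra.
Qed.

(** After [N] steps all orbits are within 1 of the bounded set [A]; the finitely many earlier images
    of [S] are compact. *)
Lemma iterates_bounded h A S : continuous h -> compact A -> compact S ->
  attracts h A S -> bounded_set [set iter n h x | n in setT & x in S].
Proof.
move=> ch cA cS att; have [N HN] := attracts_near att ltr01.
have [MA HA] : exists M : R, forall x, A x -> `|x| <= M.
  exact/bounded_setP/compact_bounded.
have ci n : continuous (iter n h).
  elim: n => [x|n IH x]; first exact: cvg_id.
  exact: (@continuous_comp _ _ _ (iter n h) h x (IH x) (ch _)).
have [MN HMN] : exists M : R, forall n x, (n < N)%N -> S x -> `|iter n h x| <= M.
  elim: N {HN} => [|N [M HM]]; first by exists 0.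
  have [M' HM'] : exists M : R, forall x, (iter N h @` S) x -> `|x| <= M.
    apply/bounded_setP/compact_bounded/continuous_compact => //.
    exact: continuous_subspaceT.
  exists (Num.max M M') => n x; rewrite ltnS leq_eqVlt => /predU1P[->|nN] Sx.
    by rewrite le_max HM' ?orbT//; exists x.
  by rewrite le_max HM.
apply/bounded_setP; exists (Num.max MN (MA + 1)) => _ [n _ [x Sx <-]].
have [nN|Nn] := ltnP n N; first by rewrite le_max HMN.
have [a Aa xa] := HN n x Nn Sx.
rewrite le_max; apply/orP; right.
rewrite -[iter n h x](subrK a) (le_trans (ler_normD _ _))//.
by rewrite addrC lerD ?HA// ltW.
Qed.

End Attraction.

Section Perturbation.
Context {R : realType} {X : completeNormedModType R}.
Variables (F : R * X -> X) (F0 : X -> X) (eps0 : R).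
Hypothesis eps0_gt0 : 0 < eps0.
Hypothesis F_compact : compact_map_on (`[- eps0, eps0]%classic `*` setT) F.
Hypothesis F_C1 : C1_map_on (`[- eps0, eps0]%classic `*` setT) F.
Hypothesis F_0 : forall x, F (0, x) = F0 x.

Let F0E : (fun x => F (0, x)) = F0. Proof. exact: funext. Qed.

Let zero_in : - eps0 < 0 < eps0. Proof. by rewrite oppr_lt0 eps0_gt0. Qed.

Lemma C1_slice eps : - eps0 < eps < eps0 -> C1_map (fun x => F (eps, x)).
Proof.
move=> heps; have [T HT] := C1_slices F_C1.
split=> [x|x]; first by have [] := HT eps x heps.
move=> B /= /nbhs_normP[eta /= eta0 etaB].
have eta2 : 0 < eta / 2 by rewrite divr_gt0.
have [_ Tx /(_ _ eta2)[d d0 Hd]] := HT eps x heps.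
apply/nbhs_normP; exists d => // y /=; rewrite distrC => yx.
have opl : (opnorm (fun v => 'd (fun x => F (eps, x)) y v -
    'd (fun x => F (eps, x)) x v)%R <= (eta / 2)%:E)%E.
  apply: opnorm_le => v v1; have [_ -> _] := HT eps y heps; rewrite Tx.
  rewrite (le_trans (Hd eps y heps _ yx v)) ?subrr ?normr0//.
  by rewrite ler_piMr// ltW.
have op0 : (0 <= opnorm (fun v => 'd (fun x => F (eps, x)) y v -
    'd (fun x => F (eps, x)) x v)%R)%E.
  by apply: le_trans (opnorm_ub _ (v := 0) _); rewrite ?normr0// lee_fin.
move: opl op0; case: (opnorm _) => [z| |]//; rewrite !lee_fin => z1 z0.
by apply: etaB => /=; rewrite sub0r normrN ger0_norm//; lra.
Qed.

(** The radius [d] from [lebesgue_number] controls the parameter and the distance to [K] at once.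
    The comparison point [a] is the centre of a covering ball and may differ from [z]. *)
Lemma diff_slice_near (K : set X) (k : R) : compact K -> 0 < k ->
  exists2 d : R, 0 < d & forall eps y, - eps0 < eps < eps0 -> `|eps| < d ->
    (exists2 z, K z & `|y - z| < d) ->
    exists2 a, K a & forall v, `|'d (fun x => F (eps, x)) y v - 'd F0 a v| <= k * `|v|.
Proof.
move=> cK k0; have [T HT] := C1_slices F_C1.
have H a : exists2 d : R, 0 < d & forall eps y, - eps0 < eps < eps0 ->
    `|eps| < d -> `|y - a| < d ->
    forall v, `|T eps y v - T 0 a v| <= k * `|v|.
  have [_ _ /(_ k k0)[d d0 Hd]] := HT 0 a zero_in.
  by exists d => // eps y heps ed ya v; apply: Hd => //; rewrite subr0.
pose rho a := projT1 (cid2 (H a)).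
have rho0 a : 0 < rho a by rewrite /rho; case: cid2.
have rhoP a eps y : - eps0 < eps < eps0 -> `|eps| < rho a -> `|y - a| < rho a ->
    forall v, `|T eps y v - T 0 a v| <= k * `|v|.
  by rewrite /rho; case: cid2 => d d0 Hd; exact: Hd.
have [d d0 Hd] := lebesgue_number cK (fun a _ => rho0 a).
exists d => // eps y heps ed [z Kz yz].
have [a [Ka _ [da /(_ y yz) ya]]] := Hd z Kz.
exists a => // v; have [_ -> _] := HT eps y heps.
have [_ + _] := HT 0 a zero_in; rewrite F0E => ->.
by apply: rhoP => //; exact: lt_trans da.
Qed.

(** Both [F (eps, y)] and [F0 z] are within [eta / 2] of the value of [F0] at a common centre
    [a]. *)
Lemma slice_near (K : set X) (eta : R) : compact K -> 0 < eta ->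
  exists2 d : R, 0 < d & forall eps y z, - eps0 < eps < eps0 -> `|eps| < d ->
    K z -> `|y - z| < d -> `|F (eps, y) - F0 z| < eta.
Proof.
move=> cK eta0.
have H a : exists2 d : R, 0 < d & forall eps y, - eps0 < eps < eps0 ->
    `|eps| < d -> `|y - a| < d -> `|F (eps, y) - F0 a| < eta / 2.
  have [cF _] := F_compact.
  have D0 : (`[- eps0, eps0]%classic `*` [set: X]) (0, a).
    by split=> //=; rewrite in_itv/= oppr_le0 ltW.
  have eta2 : 0 < eta / 2 by rewrite divr_gt0.
  have : nbhs_subspace ((0, a) : subspace (`[- eps0, eps0]%classic `*` [set: X]))
      (F @^-1` ball (F (0, a)) (eta / 2)).
    exact: (cF (0, a) _ (nbhsx_ballx (F (0, a)) _ eta2)).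
  rewrite -(nbhs_subspace_in D0) /within/= => /nbhs_normP[d /= d0 dH].
  exists d => // eps y /andP[e1 e2] ed ya.
  have := @dH (eps, y); rewrite /= prod_normE/= gt_max sub0r normrN ed distrC ya.
  rewrite -ball_normE/= distrC -(F_0 a); apply => //.
  by split=> //=; rewrite in_itv/= !ltW.
pose rho a := projT1 (cid2 (H a)).
have rho0 a : 0 < rho a by rewrite /rho; case: cid2.
have rhoP a eps y : - eps0 < eps < eps0 -> `|eps| < rho a -> `|y - a| < rho a ->
    `|F (eps, y) - F0 a| < eta / 2.
  by rewrite /rho; case: cid2 => d d0 Hd; exact: Hd.
have [d d0 Hd] := lebesgue_number cK (fun a _ => rho0 a).
exists d => // eps y z heps ed Kz yz.
have [a [Ka za [da /(_ y yz) ya]]] := Hd z Kz.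
have h1 := rhoP a eps y heps (lt_trans ed da) ya.
have h2 : `|F0 z - F0 a| < eta / 2.
  by rewrite -(F_0 z); apply: rhoP => //; rewrite normr0.
rewrite -(subrKA (F0 a)) (le_lt_trans (ler_normD _ _))//.
by rewrite (distrC (F0 a)); lra.
Qed.

(** Finite-time continuity in the parameter, uniform on [S]: the one-step estimate applies at every
    step because [K] contains the unperturbed orbits. *)
Lemma iter_slice_near (K S : set X) (eta : R) N : compact K ->
  (forall n x, S x -> K (iter n F0 x)) -> 0 < eta ->
  exists2 d : R, 0 < d & forall eps x n, - eps0 < eps < eps0 -> `|eps| < d ->
    (n <= N)%N -> S x -> `|iter n (fun y => F (eps, y)) x - iter n F0 x| < eta.
Proof.
move=> cK SK; elim: N eta => [|N IH] eta eta0.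
  exists 1 => // eps x [|n]// _ _ _ _ /=; by rewrite subrr normr0.
have [d d0 Hd] := slice_near cK eta0.
have ed0 : 0 < Num.min eta d by rewrite lt_min eta0.
have [d' d'0 Hd'] := IH _ ed0.
exists (Num.min d d') => [|eps x n heps]; first by rewrite lt_min d0.
rewrite lt_min => /andP[ed ed'] nN Sx.
case: n nN => [|n] nN; first by rewrite /= subrr normr0.
rewrite /=; apply: Hd => //; first exact: SK.
by have := Hd' eps x n heps ed' nN Sx; rewrite lt_min => /andP[].
Qed.

Variables (A : set X) (c : X) (r : R).
Hypothesis F0_C1 : C1_map F0.
Hypothesis F0_compact : compact_map_on setT F0.
Hypothesis hA : attractor F0 A.
Hypothesis hB1 : A `<=` ball c r.
Variables (C : set X) (e : X).
Hypothesis coneC : cone C.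
Hypothesis Ce : C° e.
Hypothesis e0 : e != 0.
Hypothesis F0_pos : forall x, strongly_positive C ('d F0 x).

(** [M] is the closure of the [d]-neighbourhood [V] of [A], and [U] is its [3 * d]-neighbourhood.
    One perturbed step sends [U] into the compact set [K1]; [N] unperturbed steps then lead within
    [d / 2] of [A], and the perturbed ones deviate by less than [d / 2]. Hence [N.+1] steps map [U]
    into [V]. *)
Lemma perturbed_dynamics : exists (M : set X) (q : nat) (eps1 s : R),
  [/\ closed M, bounded_set M, A `<=` M°, (0 < q)%N & 0 < eps1 <= eps0] /\
  forall eps, - eps1 < eps < eps1 ->
    iter q (fun x => F (eps, x)) @` M `<=` M /\
    forall x0, (@lebesgue_measure R).-negligible [set t : R | 0 <= t <= 1 /\
      (M (x0 + t *: (s *: e)) /\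
      (0 < lambda_max (x0 + t *: (s *: e))%R (fun x => F (eps, x)))%E)].
Proof.
have [cA FA _ attA] := hA.
pose J : set R := `[- eps0, eps0]%classic.
have J0 : J 0 by rewrite /J/= in_itv/= oppr_le0 ltW.
(* Compactness of [F] on the product gives one compact set for all parameters. *)
pose K1 := closure (F @` (J `*` ball c r)).
have cK1 : compact K1.
  rewrite -precompactE; apply: F_compact.2; first by move=> [u v] [].
  apply/bounded_setP; exists (Num.max eps0 (`|c| + r)) => -[t x] /= [Jt].
  rewrite -ball_normE/= distrC prod_normE ge_max => xc; apply/andP; split.
    rewrite le_max; apply/orP; left.
    by rewrite ler_norml; move: Jt; rewrite /J/= in_itv.
  rewrite le_max; apply/orP; right.
  by rewrite -[x](subrK c) addrC (le_trans (ler_normD _ _))// lerD2l ltW.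
have bK1 : bounded_set K1 by exact: compact_bounded.
have K1F eps x : - eps0 < eps < eps0 -> ball c r x -> K1 (F (eps, x)).
  move=> /andP[/ltW e1 /ltW e2] Bx; apply: subset_closure; exists (eps, x) => //.
  by split=> //; rewrite /J/= in_itv/= e1.
have AK1 : A `<=` K1.
  by move=> a; rewrite -FA => -[a' Aa' <-]; rewrite -F_0; apply: K1F => //; exact: hB1.
have K1A := attA K1 bK1.
pose Bd := [set iter n F0 x | n in setT & x in K1].
have bBd : bounded_set Bd by apply: (iterates_bounded _ cA cK1 K1A); exact: C1_continuous.
(* The orbits starting in [K1] form a bounded set [Bd]; one more application of the compact map [F0]
   makes it relatively compact. *)
pose K := K1 `|` closure (F0 @` Bd).
have cK : compact K.
  by apply: compactU => //; rewrite -precompactE; apply: F0_compact.2.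
have K1K n x : K1 x -> K (iter n F0 x).
  move=> K1x; case: n => [|n]; first by left.
  right; apply: subset_closure; exists (iter n F0 x) => //.
  by exists n => //; exists x.
have AK : A `<=` K by move=> a /AK1; left.
have [M0 HM0] : exists M : R, forall x, K x -> `|x| <= M.
  exact/bounded_setP/compact_bounded.
have [a0 Aa0] : A !=set0.
  have b0 : bounded_set [set 0 : X].
    by apply/bounded_setP; exists 0 => x ->; rewrite normr0.
  have [N HN] := attracts_near (attA _ b0) ltr01.
  by have [a Aa _] := HN N 0 (leqnn _) erefl; exists a.
have K0 : K !=set0 by exists a0; exact: AK.
have [k k0 Hk] :=
  segment_negligible coneC Ce e0 F0_compact F0_C1 F0_pos cK K0.
have [d1 d1_gt0 Hd1] := diff_slice_near cK k0.
have [d2 d2_gt0 Hd2] := compact_neighborhood cA hB1.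
(* The [3 * d]-neighbourhood of [A] must lie in the given ball and within [d1] of [K]. *)
pose d := Num.min d1 d2 / 3.
have d0 : 0 < d by rewrite divr_gt0// lt_min d1_gt0.
have dd1 : 3 * d <= d1.
  have : Num.min d1 d2 <= d1 by rewrite ge_min lexx.
  by rewrite /d; lra.
have dd2 : 3 * d <= d2.
  have : Num.min d1 d2 <= d2 by rewrite ge_min lexx orbT.
  by rewrite /d; lra.
have dh0 : 0 < d / 2 by rewrite divr_gt0.
have [N HN] := attracts_near K1A dh0.
have [d3 d3_gt0 Hd3] := @iter_slice_near K K1 _ N cK K1K dh0.
pose V := [set x | exists2 a, A a & `|x - a| < d].
pose U := [set x | exists2 a, A a & `|x - a| < 3 * d].
pose M := closure V.
have M2d x : M x -> exists2 a, A a & `|x - a| < 2 * d.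
  move=> /(_ _ (nbhsx_ballx x _ d0))[v [[a Aa va]]]; rewrite -ball_normE/= => xv.
  exists a => //; rewrite -(subrKA v) (le_lt_trans (ler_normD _ _))//; lra.
have MU : M `<=` U by move=> x /M2d[a Aa xa]; exists a => //; lra.
(* Segments in direction [s *: e] have length [d]: one that meets [M], which is within [2 * d] of
   [A], stays in [U]. *)
pose s := d / `|e|.
have ne : 0 < `|e| by rewrite normr_gt0.
have s0 : 0 < s by rewrite divr_gt0.
pose eps1 := Num.min eps0 (Num.min d1 d3).
exists M, N.+1, eps1, s; split.
  split=> //.
  - exact: closed_closure.
  - have [MA HMA] : exists M : R, forall x, A x -> `|x| <= M.
      exact/bounded_setP/compact_bounded.
    apply/bounded_setP; exists (MA + 2 * d) => x /M2d[a Aa xa].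
    rewrite -[x](subrK a) addrC (le_trans (ler_normD _ _))// lerD ?HMA// ltW//.
  - move=> a Aa; apply/nbhs_ballP; exists d => // x; rewrite -ball_normE/= distrC => xa.
    by apply: subset_closure; exists a.
  - by rewrite !lt_min eps0_gt0 d1_gt0 d3_gt0 ge_min lexx.
move=> eps /andP[epsl epsu].
have [heps epsd1 epsd3] : [/\ - eps0 < eps < eps0, `|eps| < d1 & `|eps| < d3].
  have : `|eps| < eps1 by rewrite ltr_norml epsl.
  by rewrite !lt_min => /and3P[+ -> ->]; rewrite ltr_norml.
set f := fun x => F (eps, x).
have UK1 x : U x -> K1 (f x).
  by move=> [a Aa xa]; apply: K1F => //; apply: (Hd2 a) => //; exact: lt_le_trans dd2.
have fclose j x : (j <= N)%N -> K1 x -> `|iter j f x - iter j F0 x| < d / 2.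
  by move=> jN K1x; exact: Hd3.
have fV x : U x -> V (iter N.+1 f x).
  move=> /UK1 K1x; rewrite iterSr; have [a Aa xa] := HN N _ (leqnn _) K1x.
  exists a => //; have xx := fclose N _ (leqnn _) K1x.
  rewrite -(subrKA (iter N F0 (f x))).
  rewrite (le_lt_trans (ler_normD _ _))//; lra.
have VU : V `<=` U by move=> x [a Aa xa]; exists a => //; lra.
split; first by move=> _ [x Mx <-]; apply: subset_closure; apply: fV; exact: MU.
(* Strong induction in blocks of [N.+1] steps. Step 0 is close to [A], steps 1 to [N] follow the
   unperturbed orbit of [f x], and after the block the orbit is back in [U]. *)
have near_K n x : U x -> exists2 z, K z & `|iter n f x - z| < d1.
  elim/ltn_ind: n x => n IH x Ux.
  have [nN|Nn] := leqP n N.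
    case: n nN {IH} => [_|n nN].
      by case: Ux => a Aa xa; exists a; [exact: AK|exact: lt_le_trans dd1].
    exists (iter n F0 (f x)); first exact/K1K/UK1.
    rewrite iterSr (lt_le_trans (fclose n _ (ltnW nN) (UK1 _ Ux)))//; lra.
  rewrite -(subnK Nn) iterD; apply: IH; last exact/VU/fV.
  by rewrite ltn_subrL (leq_ltn_trans _ Nn).
move=> x0; pose p (t : R) := x0 + t *: (s *: e).
(* A segment that misses [M] contributes the empty set of times. *)
have [[t0 /andP[t00 t01] Mt0]|noM] :=
    pselect (exists2 t : R, 0 <= t <= 1 & M (p t)); last first.
  apply: (negligibleS _ (negligible_set0 _)) => t [t01 [Mt _]].
  by apply: noM; exists t.
have pU t : 0 <= t <= 1 -> U (p t).
  move=> /andP[t0' t1']; have [a Aa ta] := M2d _ Mt0.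
  exists a => //; rewrite -(subrKA (p t0)) (le_lt_trans (ler_normD _ _))//.
  have -> : p t - p t0 = (t - t0) *: (s *: e).
    by rewrite /p opprD addrACA subrr add0r -scalerBl.
  rewrite normrZ normrZ (gtr0_norm s0) /s divfK ?gt_eqF//.
  have : `|t - t0| <= 1 by rewrite ler_norml; apply/andP; split; lra.
  move: d0 ta; nra.
have := Hk f s (M0 + d1) x0 (C1_slice heps) s0.
have H1 (t : R) n : 0 <= t <= 1 -> exists2 z, K z & forall v,
    `|'d f (iter n f (p t)) v - 'd F0 z v| <= k * `|v|.
  by move=> t01'; apply: Hd1 => //; apply: near_K; exact: pU.
have H2 (t : R) n : 0 <= t <= 1 -> `|iter n f (p t)| <= M0 + d1.
  move=> t01'; have [z Kz zn] := near_K n _ (pU _ t01').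
  by rewrite -[iter _ _ _](subrK z) addrC (le_trans (ler_normD _ _))// lerD ?HM0// ltW.
move=> /(_ H1 H2); apply: negligibleS => t [t01' [_ lt]]; by split.
Qed.

End Perturbation.

(** * Shyness *)

Section BorelSets.
Context {R : realType} {X : normedModType R}.

Lemma open_borel (O : set X) : open O -> measurable (O : set (borel_space X)).
Proof. by move=> oO; exact: sub_sigma_algebra. Qed.

Lemma closed_borel (A : set X) : closed A -> measurable (A : set (borel_space X)).
Proof.
move=> cA; rewrite -[A]setCK; apply: measurableC; apply: open_borel.
exact: closed_openC.
Qed.

(** The operator norm of the derivative of an iterate is lower semicontinuous in the point, as a
    supremum of continuous functions; eventual bounds are countable unions and intersections. *)
Lemma lambda_max_borel (h : X -> X) (M : set X) : C1_map h -> closed M ->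
  measurable ([set x | M x /\ (0 < lambda_max x h)%E] : set (borel_space X)).
Proof.
move=> hC cM.
rewrite (_ : [set x | _] = M `&` \bigcup_k \bigcup_m \bigcap_(n in [set n | (m < n)%N])
  [set x | ((expR (n%:R / k.+1%:R))%:E < opnorm ('d (iter n h) x))%E]); last first.
  apply/seteqP; split=> x [Mx].
    move=> /lambda_max_gt0P[k [m H]]; split=> //; exists k => //; exists m => //.
  move=> [k _ [m _ H]]; split=> //; apply/lambda_max_gt0P; exists k, m => n mn.
  exact: H.
apply: measurableI; first exact: closed_borel.
apply: bigcupT_measurable => k; apply: bigcupT_measurable => m.
apply: bigcap_measurable => [|n _]; first by exists m.+1 => /=.
apply: open_borel.
rewrite (_ : [set x | _] = \bigcup_(v in [set v : X | `|v| <= 1])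
  [set x | expR (n%:R / k.+1%:R) < `|'d (iter n h) x v|]); last first.
  apply/seteqP; split=> x /=.
    by move=> /ereal_sup_gt[_ [v v1 <-]]; rewrite lte_fin => H; exists v.
  move=> [v v1 /= H]; apply: lt_le_trans (opnorm_ub _ v1).
  by rewrite lte_fin.
apply: bigcup_open => v _.
apply: (@open_comp _ _ (fun x => `|'d (iter n h) x v|) [set y | _ < y]).
  move=> x _; apply: (@continuous_comp _ _ _ (fun x => 'd (iter n h) x v)).
    exact: diff_iter_continuous.
  exact: norm_continuous.
exact: open_gt.
Qed.

End BorelSets.

Section SegmentMeasure.
Context {R : realType} {X : normedModType R}.
Local Notation mu := (@lebesgue_measure R).

(** Preimages of open sets need only be measurable, so the lemma also applies to products with
    Carathéodory sets. *)
Lemma continuous_borel d (T : measurableType d) (f : T -> X) :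
  (forall O : set X, open O -> measurable (f @^-1` O)) ->
  measurable_fun setT (f : T -> borel_space X).
Proof.
move=> fO; apply: (@measurability _ _ T (borel_space X) setT f (@open X)); first by [].
move=> _ [U oU <-].
by rewrite setTI; exact: fO.
Qed.

Lemma translate_borel (W : set X) (x : X) :
  measurable (W : set (borel_space X)) ->
  measurable ([set w + x | w in W] : set (borel_space X)).
Proof.
move=> mW; have -> : [set w + x | w in W] = (fun z => z - x) @^-1` W.
  apply/seteqP; split=> [_ [w Ww <-]|z Wz] /=; first by rewrite addrK.
  by exists (z - x) => //; rewrite subrK.
have mf : measurable_fun setT ((fun z => z - x) : borel_space X -> borel_space X).
  apply: continuous_borel => O oO; apply: open_borel; apply: open_comp => // z _.
  by apply: cvgB => //; exact: cvg_cst.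
by rewrite -[_ @^-1` _]setTI; exact: mf.
Qed.

Let unit_segment_measurable : measurable (`[0%R, 1%R]%classic : set R).
Proof. exact: measurable_itv. Qed.

Definition segment_curve (v : X) (t : R) : borel_space X := t *: v.

Lemma segment_curve_measurable v : measurable_fun setT (segment_curve v).
Proof.
apply: continuous_borel => O oO; apply: open_measurable.
by apply: open_comp => // t _; exact: scalel_continuous.
Qed.

Section PushedMeasure.
Variable v : X.

(** The push-forward of Lebesgue measure on [0, 1] under t -> t v. Its mass is 1 for every [v]; for
    v = 0 it is the Dirac mass at 0. *)
Definition segment_measure : set (borel_space X) -> \bar R :=
  fun A => mu (segment_curve v @^-1` A `&` `[0%R, 1%R]%classic).

Let preimageM (A : set (borel_space X)) : measurable A ->
  measurable (segment_curve v @^-1` A : set R).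
Proof. by move=> mA; rewrite -[_ @^-1` _]setTI; exact: segment_curve_measurable. Qed.

Let segment_measure0 : segment_measure set0 = 0%E.
Proof. by rewrite /segment_measure preimage_set0 set0I measure0. Qed.

Let segment_measure_ge0 A : (0 <= segment_measure A)%E.
Proof. exact: measure_ge0. Qed.

Let segment_measure_sigma_additive : semi_sigma_additive segment_measure.
Proof.
move=> F mF tF mUF; rewrite /segment_measure preimage_bigcup setI_bigcupl.
apply: measure_semi_sigma_additive.
- by move=> n; apply: measurableI => //; exact: preimageM.
- apply/trivIsetP => /= i j _ _ ij; rewrite setIACA -preimage_setI.
  by have /trivIsetP/(_ i j I I ij) -> := tF; rewrite preimage_set0 set0I.
- rewrite -setI_bigcupl -preimage_bigcup.
  by apply: measurableI => //; exact: preimageM.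
Qed.

HB.instance Definition _ := isMeasure.Build _ _ _ segment_measure
  segment_measure0 segment_measure_ge0 segment_measure_sigma_additive.

Let segment_measure_finite : fin_num_fun segment_measure.
Proof.
move=> A mA; rewrite ge0_fin_numE ?measure_ge0//.
apply: (@le_lt_trans _ _ (mu `[0%R, 1%R]%classic)).
  by apply: le_measure; rewrite ?inE//; apply: measurableI => //; exact: preimageM.
by rewrite lebesgue_measure_itv/= lte_fin ltr01 -EFinB ltry.
Qed.

HB.instance Definition _ := Measure_isFinite.Build _ _ _
  segment_measure segment_measure_finite.

End PushedMeasure.

Lemma shy_of_segments (W : set X) (v : X) :
  measurable (W : set (borel_space X)) ->
  (forall x, mu.-negligible [set t | 0 <= t <= 1 /\ W (x + t *: v)]) ->
  shy W.
Proof.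
move=> mW W0; split=> //; exists (segment_measure v); split.
- rewrite (_ : _ setT = 1%E)//.
  have := @lebesgue_measure_itv R `[0%R, 1%R]; rewrite /= lte_fin ltr01 -EFinB subr0.
  by rewrite /segment_measure/= -[X in mu X](setTI `[0%R, 1%R]%classic).
- exists ((fun t : R => t *: v) @` `[0%R, 1%R]%classic).
    apply: continuous_compact; last exact: segment_compact.
    by apply: continuous_subspaceT => t; exact: scalel_continuous.
  rewrite /= /segment_measure (_ : _ `&` _ = set0) ?measure0//.
  by apply/seteqP; split=> // t [/= nt t01]; apply: nt; exists t.
(* The point t v lies in W + x exactly when - x + t v lies in [W]. *)
- move=> x; have [N [mN N0 WN]] := W0 (- x).
  apply/eqP; rewrite eq_le measure_ge0 andbT -N0.
  apply: le_measure; rewrite ?inE//.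
    apply: measurableI => //; rewrite -[_ @^-1` _]setTI.
    by apply: segment_curve_measurable => //; exact: translate_borel.
  move=> t [[w Ww wt]]; rewrite /= in_itv/= => t01; apply: WN; split=> //.
  by rewrite /segment_curve in wt; rewrite -wt addrC addrK.
Qed.

End SegmentMeasure.

(** * Lebesgue null sets *)

Section BoxOuterMeasure.
Context {R : realType} {d : nat}.
Local Notation V := 'rV[R]_d.
Local Notation lambda := (@lebesgue_outer_measure R d).

Lemma box_volume_ge0 (a b : V) : (forall i, a 0 i <= b 0 i) -> 0 <= box_volume a b.
Proof. by move=> ab; apply: prodr_ge0 => i _; rewrite subr_ge0. Qed.

Lemma lebesgue_outer_cover (I : countType) (D : set I) (a b : I -> V) (S : set V) :
  (forall k i, a k 0 i <= b k 0 i) -> S `<=` \bigcup_(k in D) box (a k) (b k) ->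
  (lambda S <= \esum_(k in D) (box_volume (a k) (b k))%:E)%E.
Proof.
move=> ab SD; apply: ereal_inf_lbound.
(* Numbers that code no index receive the degenerate box at 0, so that the corners are ordered at
   every index. *)
pose ext (f : I -> V) n := oapp f 0 (unpickle n).
exists (pickle @` D), (ext a), (ext b); split.
- by move=> n i; rewrite /ext; case: unpickle => //=; rewrite mxE.
- move=> x /SD[k Dk xk]; exists (pickle k); first by exists k.
  by rewrite /ext pickleK.
rewrite (reindex_esum D (pickle @` D) pickle).
  by apply: eq_esum => k _; rewrite /ext pickleK.
by split=> [k Dk|k l _ _ /(pcan_inj pickleK)//|n [k Dk <-]]; exists k.
Qed.

Let lambda0 : lambda set0 = 0%E.
Proof.
apply/eqP; rewrite eq_le; apply/andP; split.
  apply: ereal_inf_lbound; exists set0, (fun=> 0), (fun=> 0).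
  by split=> //; rewrite esum_set0.
apply: le_ereal_inf_tmp => _ [D [a [b [ab _ ->]]]].
by apply: esum_ge0 => k _; rewrite lee_fin box_volume_ge0.
Qed.

Let lambda_ge0 S : (0 <= lambda S)%E.
Proof.
apply: le_ereal_inf_tmp => _ [D [a [b [ab _ ->]]]].
by apply: esum_ge0 => k _; rewrite lee_fin box_volume_ge0.
Qed.

Let le_lambda : {homo lambda : A B / A `<=` B >-> (A <= B)%E}.
Proof.
move=> A B AB; apply: ereal_inf_le_tmp => _ [D [a [b [ab BD ->]]]].
by exists D, a, b; split=> //; exact: subset_trans BD.
Qed.

Let lambda_sigma_subadditive : sigma_subadditive lambda.
Proof.
(* Nearly optimal covers exist only for sets of finite outer measure; an infinite term makes the
   inequality trivial. *)
move=> A; have [[i ioo]|] := pselect (exists i, lambda (A i) = +oo%E).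
  rewrite (eseries_pinfty _ _ ioo) ?leey// => n _.
  by rewrite -ltNye (lt_le_trans _ (lambda_ge0 _)).
rewrite -forallNE => Aoo; apply/lee_addgt0Pr => e e0.
rewrite (le_trans _ (epsilon_trick _ _ (ltW e0)))//.
have H n : exists C : set nat * ((nat -> V) * (nat -> V)),
  [/\ forall k i, C.2.1 k 0 i <= C.2.2 k 0 i,
      A n `<=` \bigcup_(k in C.1) box (C.2.1 k) (C.2.2 k) &
      (\esum_(k in C.1) (box_volume (C.2.1 k) (C.2.2 k))%:E <=
       lambda (A n) + (e / (2 ^ n.+1)%:R)%:E)%E].
  have en : 0 < e / (2 ^ n.+1)%:R by rewrite divr_gt0// ltr0n expn_gt0.
  have fA : lambda (A n) \is a fin_num.
    by rewrite ge0_fin_numE// ltey; apply/eqP; exact: Aoo.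
  have [_ [D [a [b [ab AD ->]]]] lt] := lb_ereal_inf_adherent en fA.
  by exists (D, (a, b)); split=> //; exact: ltW.
have [C HC] := choice H.
apply: (@le_trans _ _ (\esum_(k in setT `*`` (fun n => (C n).1))
    (box_volume ((C k.1).2.1 k.2) ((C k.1).2.2 k.2))%:E)%E).
  apply: lebesgue_outer_cover => [[n k] i /=|x [n _ Anx]].
    by have [+ _ _] := HC n; exact.
  have [_ /(_ x Anx)[k Dk xk] _] := HC n.
  by exists (n, k).
rewrite -(esum_esum (a := fun n k => (box_volume ((C n).2.1 k) ((C n).2.2 k))%:E)); last first.
  by move=> n k _ _; have [ab _ _] := HC n; rewrite lee_fin box_volume_ge0.
rewrite nneseries_esumT; last first.
  by move=> n; rewrite adde_ge0// lee_fin divr_ge0// ltW.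
by apply: le_esum => n _; have [_ _] := HC n.
Qed.

HB.instance Definition _ := isOuterMeasure.Build R V lambda
  lambda0 lambda_ge0 le_lambda lambda_sigma_subadditive.

Lemma lebesgue_outer_translate (S : set V) (v : V) :
  lambda [set y | S (y + v)] = lambda S.
Proof.
have le (S' : set V) w : (lambda [set y | S' (y + w)%R] <= lambda S')%E.
  apply: le_ereal_inf_tmp => _ [D [a [b [ab SD ->]]]].
  apply: (le_trans (lebesgue_outer_cover (D := D) (a := fun k => (a k - w)%R)
    (b := fun k => (b k - w)%R) _ _)).
  - by move=> k i; rewrite !mxE lerD2r.
  - move=> y /SD[k Dk yk]; exists k => // i; move: (yk i); rewrite !mxE.
    by rewrite lerBlDr lerBrDr.
  - rewrite le_eqVlt; apply/orP; left; apply/eqP; apply: eq_esum => k _.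
    by congr (_%:E); apply: eq_bigr => i _; rewrite !mxE opprB addrA subrK.
apply/eqP; rewrite eq_le le/=.
have := le [set y | S (y + v)] (- v).
by under eq_set do rewrite /= subrK.
Qed.

Definition row_update (a : V) i (m : R) : V := \row_j (if j == i then m else a 0 j).

(* Cutting a box by a hyperplane orthogonal to an axis gives two boxes with
   the same total volume. *)
Lemma halfspace_caratheodory i (c : R) : lambda.-caratheodory [set x | x 0 i <= c].
Proof.
apply: le_caratheodory_measurable => S.
apply: le_ereal_inf_tmp => _ [D [a [b [ab SD ->]]]].
(* The level [c] is clamped to the side of the box, so a box lying on one side of the hyperplane
   gets one degenerate half. *)
pose m k := Num.min (b k 0 i) (Num.max (a k 0 i) c).
have am k : a k 0 i <= m k by rewrite le_min ab le_max lexx.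
have mb k : m k <= b k 0 i by rewrite ge_min lexx.
have volE k : (box_volume (a k) (b k))%:E = ((box_volume (a k) (row_update (b k) i (m k)))%:E +
    (box_volume (row_update (a k) i (m k)) (b k))%:E)%E.
  have vE (p q : V) : box_volume p q =
      (q 0 i - p 0 i) * \prod_(j < d | j != i) (q 0 j - p 0 j).
    by rewrite /box_volume (bigD1 i).
  rewrite -EFinD; congr (_%:E); rewrite !vE !mxE eqxx.
  have -> : \prod_(j < d | j != i) (row_update (b k) i (m k) 0 j - a k 0 j) =
      \prod_(j < d | j != i) (b k 0 j - a k 0 j).
    by apply: eq_bigr => j /negbTE ji; rewrite mxE ji.
  have -> : \prod_(j < d | j != i) (b k 0 j - row_update (a k) i (m k) 0 j) =
      \prod_(j < d | j != i) (b k 0 j - a k 0 j).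
    by apply: eq_bigr => j /negbTE ji; rewrite mxE ji.
  by rewrite -mulrDl; congr (_ * _); ring.
have ab1 k j : a k 0 j <= row_update (b k) i (m k) 0 j.
  by rewrite mxE; case: eqP => [->|].
have ab2 k j : row_update (a k) i (m k) 0 j <= b k 0 j.
  by rewrite mxE; case: eqP => [->|].
rewrite (eq_esum (fun k _ => volE k)) esumD;
  [|by move=> k _; rewrite lee_fin box_volume_ge0..].
apply: leeD; apply: lebesgue_outer_cover => // x [Sx /=].
  move=> xc; have [k Dk xk] := SD x Sx; exists k => // j; rewrite mxE.
  have := xk j; case: eqP => [->|//] /andP[-> xb] /=.
  by rewrite le_min xb le_max xc orbT.
move=> /negP; rewrite -ltNge => xc.
have [k Dk xk] := SD x Sx; exists k => // j; rewrite mxE.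
have := xk j; case: eqP => [->|//] /andP[xa ->]; rewrite andbT.
by rewrite ge_min ge_max xa (ltW xc) orbT.
Qed.

End BoxOuterMeasure.

(** * Fubini's theorem for null segments *)

Section SegmentNull.
Context {R : realType} {d : nat}.
Local Notation V := 'rV[R]_d.
Local Notation lambda := (@lebesgue_outer_measure R d).
Local Notation VC := (caratheodory_type lambda).
Local Notation mu := (@lebesgue_measure R).

Lemma bigcup_countType_measurable disp (T : measurableType disp) (I : countType)
    (P : set I) (F : I -> set T) :
  (forall i, P i -> measurable (F i)) -> measurable (\bigcup_(i in P) F i).
Proof.
move=> mF; rewrite (_ : \bigcup_(i in P) F i = \bigcup_n
  (if unpickle n is Some i then if `[< P i >] then F i else set0 else set0)).
  apply: bigcupT_measurable => n; case: unpickle => // i.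
  by case: asboolP => // /mF.
apply/seteqP; split=> [x [i Pi Fx]|x [n _]].
  by exists (pickle i) => //; rewrite pickleK; case: asboolP.
by case: unpickle => // i; case: asboolP => // Pi Fx; exists i.
Qed.

Lemma coord_caratheodory i : measurable_fun setT (fun x : VC => x 0 i : R).
Proof.
apply: (measurability (@RGenOInfty.G R)); first exact: RGenOInfty.measurableE.
move=> _ [_ [c ->] <-]; rewrite setTI.
rewrite (_ : _ @^-1` _ = ~` [set x : VC | x 0 i <= c]).
  by apply: measurableC; exact: halfspace_caratheodory.
by apply/seteqP; split=> x /=; rewrite in_itv/= andbT ltNge => /negP.
Qed.

Lemma cube_caratheodory (v : V) (e : R) :
  measurable [set x : VC | forall i, `|v 0 i - x 0 i| < e].
Proof.
rewrite (_ : [set x | _] = \bigcap_(i in [set: 'I_d])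
    ((fun x : VC => x 0 i : R) @^-1` `]v 0 i - e, v 0 i + e[%classic)).
  apply: fin_bigcap_measurable => // i _; rewrite -[_ @^-1` _]setTI.
  exact: coord_caratheodory.
apply/seteqP; split=> x H i.
  by move=> _; have := H i; rewrite /= in_itv/= distrC ltr_distl.
by have := H i I; rewrite /= in_itv/= distrC ltr_distl.
Qed.

Definition box_measure : set VC -> \bar R := lambda.

HB.instance Definition _ := isMeasure.Build _ _ _ box_measure
  (@caratheodory_measure0 R V lambda) (@caratheodory_measure_ge0 R V lambda)
  (@caratheodory_measure_sigma_additive R V lambda).

Let box_measure_sigma_finite : sigma_finite setT box_measure.
Proof.
exists (fun n => [set x : VC | forall i, `|(0 : V) 0 i - x 0 i| < n%:R]).
  apply/seteqP; split=> // x _; exists (Num.bound (`|(x : V)|)) => //= i.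
  have [_ /(_ 0 i)] : ball (0 : V) (Num.bound (`|(x : V)|))%:R (x : V).
    by rewrite -ball_normE/= sub0r normrN; exact: archi_boundP.
  by rewrite -ball_normE.
move=> n; split; first exact: cube_caratheodory.
apply: (@le_lt_trans _ _ (\esum_(k in [set tt])
    (box_volume (const_mx (- n%:R) : V) (const_mx n%:R))%:E)%E); last first.
  rewrite esum_set1 ?ltry// lee_fin box_volume_ge0// => i.
  by rewrite !mxE; have := ler0n R n; lra.
apply: lebesgue_outer_cover => [_ i|x xn]; first by rewrite !mxE; have := ler0n R n; lra.
exists tt => // i; rewrite !mxE; have := xn i; rewrite !mxE sub0r normrN ltr_norml.
by move=> /andP[/ltW -> /ltW ->].
Qed.

HB.instance Definition _ := Measure_isSigmaFinite.Build _ _ _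
  box_measure box_measure_sigma_finite.

(** An open set is the countable union of the cubes with rational centre and radius 1 / (k + 1) that
    it contains, and each cube is a measurable rectangle. *)
Lemma open_prod_caratheodory (O : set (R * V)) : open O ->
  measurable (O : set (R * VC)).
Proof.
move=> oO.
pose cube (j : rat * 'rV[rat]_d * nat) : set (R * VC) :=
  [set p | `|ratr j.1.1 - p.1| < j.2.+1%:R^-1 /\
     forall i, `|(map_mx ratr j.1.2 : V) 0 i - (p.2 : V) 0 i| < j.2.+1%:R^-1].
rewrite (_ : O = \bigcup_(j in [set j | cube j `<=` O]) cube j).
  apply: bigcup_countType_measurable => -[[q v] k] _.
  rewrite (_ : cube _ = `]ratr q - k.+1%:R^-1, ratr q + k.+1%:R^-1[%classic `*`
    [set x : VC | forall i, `|(map_mx ratr v : V) 0 i - x 0 i| < k.+1%:R^-1]).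
    by apply: measurableX; [exact: measurable_itv|exact: cube_caratheodory].
  apply/seteqP; split=> -[s x] /= [H1 H2]; split=> //.
    by move: H1; rewrite /= in_itv/= distrC ltr_distl.
  by move: H1; rewrite /= in_itv/= distrC ltr_distl.
apply/seteqP; split=> [[s x] Osx|p [j jO jp]]; last exact: jO.
have [[A B] /= [/nbhs_ballP[e1 /= e10 e1A] /nbhs_ballP[e2 /= e20 e2B]] ABO] :
  nbhs (s, x) O by apply: open_nbhs_nbhs; split.
pose e := Num.min e1 e2; have e0 : 0 < e by rewrite lt_min e10.
(* A cube around a rational point near (s, x) reaches at most twice its radius from (s, x), hence
   [e / 2]. *)
have [k ke] : exists k : nat, k.+1%:R^-1 < e / 2.
  have e20' : 0 < e / 2 by rewrite divr_gt0.
  near \oo => k; exists k; near: k; exact: near_infty_natSinv_lt (PosNum e20').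
have k0 : 0 < k.+1%:R^-1 :> R by rewrite invr_gt0 ltr0n.
have approx (z : R) : exists q : rat, `|ratr q - z| < k.+1%:R^-1.
  have zk : z < z + k.+1%:R^-1 by rewrite ltrDl.
  have [q] := rat_in_itvoo zk; rewrite in_itv/= => /andP[zq qz].
  by exists q; rewrite ger0_norm ?subr_ge0 ?ltW// ltrBlDl.
have [q Hq] := approx s.
have [w Hw] : exists w : 'rV[rat]_d, forall i, `|ratr (w 0 i) - x 0 i| < k.+1%:R^-1.
  have [f Hf] := choice (fun i => approx (x 0 i)).
  by exists (\row_i f i) => i; rewrite mxE.
exists (q, w, k); last first.
  by split=> // i; rewrite mxE.
move=> [s' x'] [/= Hs' Hx']; apply: ABO; split => /=.
  apply: e1A; rewrite -ball_normE/=.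
  have ee1 : e <= e1 by rewrite ge_min lexx.
  rewrite -(subrKA (ratr q)); apply: (le_lt_trans (ler_normD _ _)).
  rewrite (distrC s); apply: lt_le_trans ee1; rewrite [ltRHS]splitr.
  by apply: ltrD; apply: lt_trans ke.
apply: e2B; split=> // i j; rewrite (ord1 i).
have ee2 : e <= e2 by rewrite ge_min lexx orbT.
have h2 := Hw j; have h1 := Hx' j; move: h1; rewrite mxE -ball_normE/= => h1.
rewrite -(subrKA (ratr (w 0 j))); apply: (le_lt_trans (ler_normD _ _)).
rewrite (distrC (x 0 j)); apply: lt_le_trans ee2; rewrite [ltRHS]splitr.
by apply: ltrD; apply: lt_trans ke.
Unshelve. all: by end_near. Qed.

Variable X : normedModType R.

(** Let [Z] be the set of (t, y) with t in [0, 1] and y + t u in the preimage of [W]. Its sections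
    at fixed y are null, so [Z] is null by Fubini; its sections at fixed t are translates of the
    preimage, so its measure is also the outer measure of the preimage. *)
Lemma lebesgue_null_of_segments (L : V -> X) (W : set X) (u : V) :
  continuous L -> measurable (W : set (borel_space X)) ->
  (forall y, mu.-negligible [set t : R | 0 <= t <= 1 /\ W (L (y + t *: u))]) ->
  lebesgue_null (L @^-1` W).
Proof.
move=> cL mW W0.
pose f (p : R * VC) : borel_space X := L ((p.2 : V) + p.1 *: u).
have mf : measurable_fun setT f.
  apply: continuous_borel => O oO; apply: open_prod_caratheodory.
  apply: (@open_comp _ _ (fun p : R * V => L (p.2 + p.1 *: u))) => // p _.
  apply: (@continuous_comp _ _ _ (fun p : R * V => p.2 + p.1 *: u) L); last exact: cL.
  apply: cvgD; first exact: cvg_snd.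
  by apply: cvgZr_tmp; exact: cvg_fst.
pose Z : set (R * VC) := (`[0%R, 1%R]%classic `*` setT) `&` f @^-1` W.
have mZ : measurable Z.
  apply: measurableI; last by rewrite -[_ @^-1` _]setTI; exact: mf.
  by apply: measurableX => //; exact: measurable_itv.
have E : (mu \x box_measure)%E Z =
    (mu \x^ box_measure)%E Z.
  apply: product_measure_unique => // A B mA mB.
  exact: product_measure2E.
have E2 : (mu \x^ box_measure)%E Z = 0%E.
  apply: integral0_eq => y _ /=.
  have [N [mN N0 WN]] := W0 y.
  apply/eqP; rewrite eq_le measure_ge0 andbT -N0.
  apply: le_measure; rewrite ?inE//; first exact: measurable_ysection.
  move=> t; rewrite /ysection/= inE => -[[t01 _] Wt]; apply: WN; split=> //.
have E1 : (mu \x box_measure)%E Z = lambda (L @^-1` W).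
  rewrite /product_measure1.
  pose g : R -> \bar R := cst (lambda (L @^-1` W)).
  pose I01 : set R := `[0%R, 1%R]%classic.
  rewrite (@eq_integral _ _ _ mu _ (g \_ I01)); last first.
    move=> t _; rewrite /= patchE; case: ifPn => [/set_mem t01|/negP t01].
      transitivity (lambda [set y | (L @^-1` W) (y + t *: u)%R]); last first.
        exact: lebesgue_outer_translate.
      rewrite [LHS]/(lambda (xsection Z t)); congr (lambda _).
      apply/seteqP; split=> y; rewrite /xsection/= inE.
        by move=> -[_ ].
      by move=> Wy; split.
    rewrite (_ : xsection Z t = set0) ?measure0//.
    apply/seteqP; split=> // y; rewrite /xsection/= inE => -[[Jt _] _].
    by apply: t01; rewrite inE.
  rewrite -integral_mkcond integral_cst/=; last exact: measurable_itv.
  by rewrite lebesgue_measure_itv/= lte_fin ltr01 -EFinB subr0 mule1.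
by rewrite /lebesgue_null -E1 E.
Qed.

End SegmentNull.

Section RowVectors.
Context {R : realType} {X : normedModType R} {d : nat}.

Lemma linear_rV_continuous (L : {linear 'rV[R]_d -> X}) : continuous L.
Proof.
have -> : (L : 'rV[R]_d -> X) = fun y => \sum_(j < d) y 0 j *: L (delta_mx 0 j).
  apply/funext => y; rewrite {1}[y]row_sum_delta linear_sum.
  by apply: eq_bigr => j _; rewrite linearZZ.
elim: (index_enum _) => [|j r IH].
  by under eq_fun do rewrite big_nil; exact: cst_continuous.
under eq_fun do rewrite big_cons.
move=> y; have cj : {for y, continuous (fun z : 'rV[R]_d => z 0 j)}.
  exact: coord_continuous.
exact: (continuousD (continuousZr_tmp (a := L (delta_mx 0 j)) cj) (IH y)).
Qed.

End RowVectors.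

(** * The zero space and the final assembly *)

Section TrivialSpace.
Context {R : realType} {X : normedModType R}.

(** If 0 is interior, both x and - x belong to [C] for every x. This settles the case where the
    chosen interior vector is 0. *)
Lemma cone_interior0 (C : set X) : cone C -> C° 0 -> forall x : X, x = 0.
Proof.
move=> coneC C0; have [m m0 H] := cone_order_unit coneC C0.
move=> x; apply: (cone_pointed coneC).
  by have := H (m * `|x|) x (lexx _); rewrite scaler0 add0r.
by have := H (m * `|- x|) (- x) (lexx _); rewrite scaler0 add0r.
Qed.

Lemma lambda_max_trivial (h : X -> X) x : (forall y : X, y = 0) ->
  ~ (0 < lambda_max x h)%E.
Proof.
move=> X0 /lambda_max_gt0P[k [m /(_ m.+1 (ltnSn m))]].
apply/negP; rewrite -leNgt; apply: le_trans (opnorm_le (k := 0) _) _.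
  by move=> v _; rewrite [X in `|X|]X0 normr0.
by rewrite lee_fin expR_ge0.
Qed.

End TrivialSpace.

Theorem theoremB (R : realType) (X : completeNormedModType R) (C : set X)
    (hsep : separable X) (hC : strongly_ordered C)
    (F0 : X -> X)
    (hF0_compact : compact_map_on setT F0)
    (hF0_C1 : C1_map F0)
    (hF0_pos : forall x, strongly_positive C ('d F0 x))
    (hF0_diss : pointwise_dissipative F0)
    (A : set X) (hA : attractor F0 A)
    (c : X) (r : R) (hr : 0 < r) (hB1 : A `<=` ball c r)
    (eps0 : R) (heps0 : 0 < eps0) :
  let J : set R := `[- eps0, eps0]%classic in
  let B1 : set X := ball c r in
  exists eta : R, 0 < eta /\
  forall F : R * X -> X,
    compact_map_on (J `*` setT) F ->
    C1_map_on (J `*` setT) F ->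
    (forall x, F (0, x) = F0 x) ->
    (ereal_sup [set (`|F (e, x) - F0 x|%R)%:E +
        opnorm (fun v : X => 'd (fun y : X => F (e, y)) x v - 'd F0 x v)%R
      | e in J & x in B1] < eta%:E)%E ->
  exists (M : set X) (q : nat) (eps1 : R),
    [/\ closed M, bounded_set M, A `<=` M°, (0 < q)%N & 0 < eps1 <= eps0] /\
    forall eps : R, - eps1 < eps < eps1 ->
      let Feps : X -> X := fun x => F (eps, x) in
      let S : set X := [set x | M x /\ (0 < lambda_max x Feps)%E] in
      [/\ iter q Feps @` M `<=` M,
          shy S
        & forall (d : nat) (T : {linear X -> 'rV[R]_d}),
            bijective T -> lebesgue_null (T @` S)].
Proof.
move=> J B1; exists 1; split=> // F Fc FC F0E _.
have [coneC [e Ce]] := hC.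
have null0 : (@lebesgue_measure R).-negligible set0 by exact: negligible_set0.
have [e0|e0] := eqVneq e 0.
  have X0 : forall x : X, x = 0 by apply: (cone_interior0 coneC); rewrite -e0.
  exists setT, 1%N, eps0; split.
    split=> //; rewrite ?interiorT ?heps0 ?lexx//.
    by apply/bounded_setP; exists 0 => x _; rewrite [x]X0 normr0.
  move=> eps heps Feps S.
  have -> : S = set0.
    by apply/seteqP; split=> // x [_ /(lambda_max_trivial X0)].
  split=> //.
  - apply: (@shy_of_segments _ _ _ 0); first exact: measurable0.
    by move=> x; apply: negligibleS null0 => t [].
  - by move=> d T _; rewrite image_set0; exact: (outer_measure0 (@lebesgue_outer_measure R d)).
have [M [q [eps1 [s [[cM bM AM q0 /andP[eps10 eps1le]] H]]]]] :=
  perturbed_dynamics heps0 Fc FC F0E hF0_C1 hF0_compact hA hB1 coneC Ce e0 hF0_pos.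
exists M, q, eps1; split; first by split; rewrite ?eps10.
move=> eps heps Feps S; have [Mq Mnull] := H eps heps.
have heps' : - eps0 < eps < eps0 by lra.
have hC1 : C1_map Feps by exact: (C1_slice FC heps').
have mS : measurable (S : set (borel_space X)) by exact: lambda_max_borel.
split=> //; first exact: shy_of_segments mS Mnull.
move=> d T [g Tg gT].
have glin : linear g.
  by move=> a u v; apply: (can_inj Tg); rewrite linearP !gT.
pose gM := GRing.isLinear.Build _ _ _ _ _ glin.
pose L : {linear 'rV[R]_d -> X} := HB.pack g gM.
(* With [L] the inverse of [T], the image becomes a preimage. Segments in direction [T (s *: e)] are
   carried by [L] to segments in direction [s *: e], already known to be null. *)
have -> : T @` S = L @^-1` S.
  apply/seteqP; split=> [_ [x Sx <-]|y Sy] /=; first by rewrite /L/= Tg.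
  by exists (g y) => //; rewrite gT.
apply: (lebesgue_null_of_segments (u := T (s *: e))) => //.
  exact: linear_rV_continuous.
move=> y; have := Mnull (L y); apply: negligibleS => t [t01].
by rewrite linearD linearZZ [L (T _)]Tg.
Qed.
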